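(* Let $m\ge 1$, $1\le p<\infty$, let $X$ be any one of the four sets $\widetilde{S}^{m}$, $E^{m}$, $S_0^{m}$, $S^{m}$, and let $U\subset X$. Let $\overline{U}$ denote the closure of $U$ in $(F_B(\mathbb{R}^m)^p,d_p)$. Then $U$ is compact in $(X,d_p)$ if and only if (i) $U$ is uniformly $p$-mean bounded; (ii) $U$ is $p$-mean equi-left-continuous; and (iii) $\overline{U}=U$.
   Context: $H$ is the Hausdorff metric on nonempty closed subsets of $\mathbb{R}^m$ (Euclidean distance): $H(A,B)=\max\{\sup_{a\in A}\inf_{b\in B}d(a,b),\ \sup_{b\in B}\inf_{a\in A}d(a,b)\}$ (possibly $+\infty$). A fuzzy set on $\mathbb{R}^m$ is a function $u:\mathbb{R}^m\to[0,1]$; its cuts are $[u]_\alpha=\{x: u(x)\ge\alpha\}$ for $\alpha\in(0,1]$ and $[u]_0=\overline{\{x: u(x)>0\}}$. $F_B(\mathbb{R}^m)$ is the set of fuzzy sets $u$ on $\mathbb{R}^m$ that are normal ($u(x_0)=1$ for some $x_0$), upper semi-continuous, and have $[u]_0$ bounded. $F_B(\mathbb{R}^m)^p\supset F_B(\mathbb{R}^m)$ is the set of normal upper semi-continuous fuzzy sets $u$ with $\left(\int_0^1 H([u]_\alpha,\{0\})^p\,d\alpha\right)^{1/p}<+\infty$, where $0$ is the origin. The metric is $d_p(u,v)=\left(\int_0^1 H([u]_\alpha,[v]_\alpha)^p\,d\alpha\right)^{1/p}$. Subsets of $F_B(\mathbb{R}^m)$: - $E^{m}$: those $u$ that are fuzzy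 convex, i.e. $u(\lambda x+(1-\lambda)y)\ge\min\{u(x),u(y)\}$ for all $x,y\in\mathbb{R}^m$, $\lambda\in[0,1]$; - $S_0^{m}$: those $u$ with $u(\lambda y)\ge u(y)$ for all $y\in\mathbb{R}^m$, $\lambda\in[0,1]$; - $S^{m}$: those $u$ for which there is $x\in\mathbb{R}^m$ with $u(\lambda y+(1-\lambda)x)\ge u(y)$ for all $y\in\mathbb{R}^m$, $\lambda\in[0,1]$; - $\widetilde{S}^{m}$: those $u$ such that for every $\alpha\in(0,1]$ there is $x_\alpha\in[u]_\alpha$ such that for all $y\in[u]_\alpha$ the segment $\overline{x_\alpha y}$ is contained in $[u]_\alpha$. A set $U\subset F_B(\mathbb{R}^m)^p$ is uniformly $p$-mean bounded if there is $M>0$ with $d_p(u,\widehat{0})\le M$ for all $u\in U$, where $\widehat 0$ is the characteristic function of $\{0\}$. $U$ is $p$-mean equi-left-continuous if for every $\varepsilon>0$ there is $\delta>0$ such that for all $0\le h<\delta$ and all $u\in U$, $\left(\int_h^1 H([u]_\alpha,[u]_{\alpha-h})^p\,d\alpha\right)^{1/p}<\varepsilon$. *)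

(* Defs.v *)
From HB Require Import structures.
From mathcomp Require Import all_boot all_order all_algebra.
From mathcomp Require Import all_classical all_reals all_analysis.
Import Order.TTheory GRing.Theory Num.Theory.
Import numFieldNormedType.Exports.

Set Implicit Arguments.
Unset Strict Implicit.
Unset Printing Implicit Defensive.

Local Open Scope classical_set_scope.
Local Open Scope ring_scope.

Section hausdorff.
Context {R : realType} {m : nat}.
Implicit Types (x y : 'rV[R]_m) (A B : set 'rV[R]_m).

(* The library's norm on 'rV[R]_m is the sup norm; its topology and bounded
   sets are the Euclidean ones. *)
Definition edist x y : R := Num.sqrt (\sum_(i < m) (x 0 i - y 0 i) ^+ 2).

Definition hausdorff A B : \bar R :=
  maxe (ereal_sup [set ereal_inf [set (edist a b)%:E | b in B] | a in A])
       (ereal_sup [set ereal_inf [set (edist a b)%:E | a in A] | b in B]).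

End hausdorff.

Section fuzzy_sets.
Context {R : realType} {m : nat}.
Implicit Types (u v : 'rV[R]_m -> R) (p : R).

(* Only used for 0 <= alpha <= 1; the else branch is the 0-cut. *)
Definition cut u (alpha : R) : set 'rV[R]_m :=
  if 0 < alpha then [set x | alpha <= u x] else closure [set x | 0 < u x].

Definition fuzzy u := forall x, 0 <= u x <= 1.

Definition fuzzy_normal u := exists x0, u x0 = 1.

Definition fuzzy_usc u := lower_semicontinuous (fun x => (- u x)%:E).

Definition FB : set ('rV[R]_m -> R) :=
  [set u | [/\ fuzzy u, fuzzy_normal u, fuzzy_usc u & bounded_set (cut u 0)]].

Definition in_FBp p u :=
  [/\ fuzzy u, fuzzy_normal u, fuzzy_usc u &
      ((\int[lebesgue_measure]_(alpha in `[0%R, 1%R])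
          hausdorff (cut u alpha) [set 0%R] `^ p) `^ p^-1 < +oo)%E].

Definition d_ p u v : \bar R :=
  ((\int[lebesgue_measure]_(alpha in `[0%R, 1%R])
      hausdorff (cut u alpha) (cut v alpha) `^ p) `^ p^-1)%E.

Definition zerohat : 'rV[R]_m -> R := \1_[set 0].

Definition E_ : set ('rV[R]_m -> R) :=
  [set u | FB u /\ forall x y (lambda : R), 0 <= lambda <= 1 ->
     Num.min (u x) (u y) <= u (lambda *: x + (1 - lambda) *: y)].

Definition S0_ : set ('rV[R]_m -> R) :=
  [set u | FB u /\ forall y (lambda : R), 0 <= lambda <= 1 ->
     u y <= u (lambda *: y)].

Definition S_ : set ('rV[R]_m -> R) :=
  [set u | FB u /\ exists x, forall y (lambda : R), 0 <= lambda <= 1 ->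
     u y <= u (lambda *: y + (1 - lambda) *: x)].

Definition Stilde : set ('rV[R]_m -> R) :=
  [set u | FB u /\ forall alpha : R, 0 < alpha <= 1 ->
     exists2 x, cut u alpha x & forall y, cut u alpha y ->
       forall lambda : R, 0 <= lambda <= 1 ->
         cut u alpha (lambda *: y + (1 - lambda) *: x)].

End fuzzy_sets.

Arguments E_ : clear implicits.
Arguments S0_ : clear implicits.
Arguments S_ : clear implicits.
Arguments Stilde : clear implicits.

Record FBp (R : realType) (m : nat) (p : R) := MkFBp {
  FBp_fun :> 'rV[R]_m -> R ;
  FBpP : in_FBp p FBp_fun }.

HB.instance Definition _ R m p := gen_eqMixin (@FBp R m p).
HB.instance Definition _ R m p := gen_choiceMixin (@FBp R m p).

Section FBp_topology.
Context {R : realType} {m : nat} {p : R}.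

Definition dp_open : set_system (FBp m p) :=
  [set A : set (FBp m p) | forall u : FBp m p, A u -> exists2 e : R, 0 < e &
     [set v : FBp m p | (d_ p u v < e%:E)%E] `<=` A].

Let dp_openT : dp_open setT.
Proof. by move=> u _; exists 1. Qed.

Let dp_openI : setI_closed dp_open.
Proof.
move=> A B oA oB u [/oA[e e0 eA] /oB[f f0 fB]].
exists (Num.min e f); first by rewrite lt_min e0.
move=> v /=; rewrite EFin_min lt_min => /andP[ve vf].
by split; [exact: eA|exact: fB].
Qed.

Let dp_open_bigU (I : Type) (f : I -> set (FBp m p)) :
  (forall i, dp_open (f i)) -> dp_open (\bigcup_i f i).
Proof.
move=> of_ u [i _ /of_[e e0 ef]]; exists e => // v /ef fv.
by exists i.
Qed.

HB.instance Definition _ :=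
  @isOpenTopological.Build (FBp m p) dp_open dp_openT dp_openI dp_open_bigU.

End FBp_topology.

Section mean_conditions.
Context {R : realType} {m : nat} {p : R}.
Implicit Types U : set (FBp m p).

Definition uniformly_mean_bounded U :=
  exists2 M : R, 0 < M & forall u, U u -> (d_ p u zerohat <= M%:E)%E.

Definition mean_equi_left_continuous U :=
  forall eps : R, 0 < eps -> exists2 delta : R, 0 < delta &
    forall (h : R) u, 0 <= h < delta -> U u ->
      ((\int[lebesgue_measure]_(alpha in `[h, 1%R])
          hausdorff (cut u alpha) (cut u (alpha - h)%R) `^ p) `^ p^-1
        < eps%:E)%E.

End mean_conditions.

(* FB is contained in F_B^p, so E_, S0_, S_ and Stilde lose no element when
   pulled back along FBp_fun. *)
Lemma FB_in_FBp (R : realType) (m : nat) (p : R) (u : 'rV[R]_m -> R) :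
  1 <= p -> FB u -> in_FBp p u.
Proof.
move=> p1 [fu [x0 ux0] uu bu]; split=> //; first by exists x0.
have p0 : 0 < p by exact: lt_le_trans p1.
apply: poweR_lty.
have [M [Mr MB]] := bu.
pose C := `|M| + 1.
have MC : M < C by rewrite (le_lt_trans (ler_norm _))// ltrDl.
have uC x : cut u 0 x -> `|x| <= C by exact: (MB C MC x).
have C0 : 0 <= C by rewrite addr_ge0.
pose D := Num.sqrt (C ^+ 2 *+ m).
have eD x : cut u 0 x -> edist x 0 <= D.
  move=> /uC xC; apply: ler_wsqrtr.
  rewrite -[X in _ *+ X]card_ord -sumr_const ler_sum// => i _.
  rewrite mxE subr0 -real_normK ?num_real// ler_sqr ?nnegrE//.
  apply: le_trans xC; rewrite [leRHS]/Num.norm/= mx_normrE.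
  exact: (le_bigmax _ (fun ij => `|x ij.1 ij.2|) (ord0, i)).
have D0 : 0 <= D by exact: sqrtr_ge0.
have cut0 a x : cut u a x -> cut u 0 x.
  rewrite /cut ltxx; case: ifPn => // a0 /(lt_le_trans a0) ux.
  exact: subset_closure.
have cutx0 a : a <= 1 -> cut u a x0.
  move=> a1; rewrite /cut; case: ifPn => _ /=; first by rewrite ux0.
  by apply: subset_closure; rewrite /= ux0.
have hD a : a <= 1 -> (hausdorff (cut u a) [set 0%R] <= D%:E)%E.
  move=> a1; rewrite /hausdorff ge_max; apply/andP; split.
    apply: ge_ereal_sup => _ /= [b Bb <-].
    apply: ge_ereal_inf; exists (edist b 0)%:E; first by exists 0.
    by rewrite lee_fin; exact/eD/cut0/Bb.
  apply: ge_ereal_sup => _ /= [b -> <-].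
  apply: ge_ereal_inf; exists (edist x0 0)%:E.
    by exists x0 => //; exact: cutx0.
  by rewrite lee_fin; exact/eD/cutx0.
have h0 a : a <= 1 -> (0 <= hausdorff (cut u a) [set 0%R])%E.
  move=> a1; rewrite /hausdorff le_max; apply/orP; left.
  apply: le_ereal_sup_tmp; exists (ereal_inf [set (edist x0 b)%:E | b in [set 0]]).
    by exists x0 => //; exact: cutx0.
  by apply: le_ereal_inf_tmp => _ [b _ <-]; rewrite lee_fin sqrtr_ge0.
rewrite integral_mkcond ge0_integralTE; last first.
  by move=> a; rewrite patchE; case: ifPn => // _; exact: poweR_ge0.
apply: (@le_lt_trans _ _ (\int[lebesgue_measure]_(a in `[0%R, 1%R])
    (cst (D%:E `^ p) a))%E); last first.
  rewrite integral_cst//= lebesgue_measure_itv/= lte01 sube0 mule1.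
  exact: ltry.
rewrite [leRHS]integral_mkcond ge0_integralTE; last first.
  by move=> a; rewrite patchE; case: ifPn => // _; exact: poweR_ge0.
apply: ereal_sup_le => _ [h hle <-]; exists h => // x.
apply: le_trans (hle x) _; rewrite !patchE; case: ifPn => //.
rewrite inE/= in_itv/= => /andP[_ x1].
rewrite -poweR_EFin; apply: gt0_ler_poweR; rewrite ?in_itv/= ?leey ?andbT ?hD ?h0 ?lee_fin//; exact: ltW.
Qed.

(* Main.v *)
(* Since [U] lies in [X], compactness in the subspace [X] is compactness in
   [FBp], and the shape of the cuts plays no role.

   Necessity. [d_ p] is a metric by Minkowski's inequality, so a compact [U] is
   closed and bounded. For a single [u] the integral of [H([u]_a, [u]_(a-h))^p]
   tends to [0] with [h]: near [a = 0] it is dominated by the integral of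
   [H([u]_a, {0})^p], and elsewhere the cuts are left continuous in [a] and
   dominated convergence applies. The bound passes to a neighbourhood of [u],
   and by compactness to [U].

   Sufficiency. Let [F] be an ultrafilter on [U]. Mean boundedness confines
   [[u]_a], for each [a > 0], to a ball independent of [u], so [[u]_a] has a
   Hausdorff limit [K_a] along [F]. Let [v] be the fuzzy set whose [a]-cut is
   the intersection of the [K_b], [b < a]. By monotonicity in [a], closeness of
   [[u]_t] to [K_t] for [t] in a grid of step [h / 2] gives
     [H([u]_a, [v]_a) <= e + H([u]_(a-h), [u]_a) + H([u]_a, [u]_(a+h))]
   for all [h < a <= 1 - h], and equi-left-continuity makes the right-hand side
   small in p-mean, without any convergence theorem along [F]. The same
   condition bounds the p-mean of [H([u]_a, {0})] near [a = 0] uniformly in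
   [u], so [F] converges to [v]. *)
Require Import Defs.
From mathcomp Require Import all_boot all_order all_algebra.
From mathcomp Require Import all_classical all_reals all_analysis.
From mathcomp Require Import measurable_realfun ring lra.
Import Order.TTheory GRing.Theory Num.Theory.
Import numFieldNormedType.Exports.

Set Implicit Arguments.
Unset Strict Implicit.
Unset Printing Implicit Defensive.

Local Open Scope classical_set_scope.
Local Open Scope ring_scope.

Local Notation edist := Defs.edist.
Local Notation cut := Defs.cut.

(** * Euclidean distance and its comparison with the sup norm *)

Section euclidean_distance.
Context {R : realType} {m : nat}.
Implicit Types (x y z : 'rV[R]_m).

Lemma edist_ge0 x y : 0 <= edist x y.
Proof. exact: sqrtr_ge0. Qed.

Lemma edistxx x : edist x x = 0.
Proof. by rewrite /edist big1 ?sqrtr0// => i _; rewrite subrr expr0n. Qed.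

Lemma edistC x y : edist x y = edist y x.
Proof.
by rewrite /edist; congr Num.sqrt; apply: eq_bigr => i _; rewrite -sqrrN opprB.
Qed.

(** Minkowski's inequality for finite sums, from Cauchy-Schwarz. The latter follows from the
    nonnegativity of the sum of [(t * a i - s * b i) ^+ 2] when [s * t] is positive; otherwise one
    of the two families vanishes. *)
Lemma sqrt_sum_sqrD (a b : 'I_m -> R) :
  Num.sqrt (\sum_i (a i + b i) ^+ 2) <=
  Num.sqrt (\sum_i a i ^+ 2) + Num.sqrt (\sum_i b i ^+ 2).
Proof.
have sq0 (c : 'I_m -> R) : 0 <= \sum_i c i ^+ 2.
  by apply: sumr_ge0 => i _; exact: sqr_ge0.
set s := Num.sqrt (\sum_i a i ^+ 2); set t := Num.sqrt (\sum_i b i ^+ 2).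
have s2 : s ^+ 2 = \sum_i a i ^+ 2 by rewrite sqr_sqrtr.
have t2 : t ^+ 2 = \sum_i b i ^+ 2 by rewrite sqr_sqrtr.
have s0 : 0 <= s by exact: sqrtr_ge0.
have t0 : 0 <= t by exact: sqrtr_ge0.
have CS : \sum_i a i * b i <= s * t.
  have [st|] := ltP 0 (s * t).
    have : 0 <= \sum_i (t * a i - s * b i) ^+ 2 by exact: sq0.
    have -> : \sum_i (t * a i - s * b i) ^+ 2 =
        t ^+ 2 * s ^+ 2 + s ^+ 2 * t ^+ 2 - 2 * (s * t) * \sum_i a i * b i.
      rewrite s2 t2 !mulr_sumr -sumrN -!big_split/=; apply: eq_bigr => i _.
      by rewrite -s2 -t2; ring.
    nra.
  move=> st; have {}st : s * t = 0 by apply/le_anti; rewrite st mulr_ge0.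
  have z (c d : 'I_m -> R) : \sum_i c i ^+ 2 = 0 -> \sum_i c i * d i = 0.
    move=> /eqP; rewrite psumr_eq0 => [/allP c0|i _]; last exact: sqr_ge0.
    rewrite big1// => i _.
    by have /implyP := c0 i (mem_index_enum _); rewrite sqrf_eq0 => /(_ isT)/eqP->; rewrite mul0r.
  rewrite st; move/eqP : st; rewrite mulf_eq0 => /orP[]/eqP st.
    by rewrite z// -s2 st expr0n.
  by under eq_bigr do rewrite mulrC; rewrite z// -t2 st expr0n.
have st0 : 0 <= s + t by rewrite addr_ge0.
rewrite -(ger0_norm st0) -sqrtr_sqr ler_wsqrtr// sqrrD s2 t2.
under eq_bigr do rewrite sqrrD.
by rewrite !big_split/= lerD2r lerD2l mulr2n lerD.
Qed.

Lemma edist_triangle y x z : edist x z <= edist x y + edist y z.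
Proof.
rewrite /edist; apply: le_trans (sqrt_sum_sqrD _ _).
rewrite le_eqVlt; apply/orP; left; apply/eqP; congr Num.sqrt.
by apply: eq_bigr => i _; rewrite subrKA.
Qed.

Lemma normB_le_edist x y : `|x - y| <= edist x y.
Proof.
rewrite [leLHS]/Num.norm/= mx_normrE (bigmax_le _ (edist_ge0 _ _))//= => -[i j] _.
rewrite ord1 /= !mxE -sqrtr_sqr ler_wsqrtr// (bigD1 j)//= lerDl.
by apply: sumr_ge0 => k _; exact: sqr_ge0.
Qed.

Lemma edist_le_normB x y : edist x y <= Num.sqrt m%:R * `|x - y|.
Proof.
rewrite -[X in _ * X]ger0_norm// -sqrtr_sqr -sqrtrM// ler_wsqrtr//.
rewrite mulr_natl -[X in _ *+ X]card_ord -sumr_const ler_sum// => i _.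
rewrite -real_normK ?num_real// ler_sqr ?nnegrE//.
rewrite [leRHS]/Num.norm/= mx_normrE.
have := le_bigmax 0 (fun ij : 'I_1 * 'I_m => `|(x - y) ij.1 ij.2|) (ord0, i).
by rewrite /= !mxE.
Qed.

Lemma near_edist x (e : R) : 0 < e -> \forall y \near x, edist x y < e.
Proof.
(* The summand [1] makes the factor positive, so that it can be divided by. *)
move=> e0; have s0 : 0 < Num.sqrt m%:R + 1 :> R by rewrite ltr_wpDl ?sqrtr_ge0.
near=> y; apply: (le_lt_trans (edist_le_normB _ _)).
apply: (@le_lt_trans _ _ ((Num.sqrt m%:R + 1) * `|x - y|)).
  by rewrite ler_wpM2r// lerDl.
rewrite mulrC -ltr_pdivlMr//; near: y.
by apply: cvgr_dist_lt; rewrite // divr_gt0.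
Unshelve. all: by end_near. Qed.

Lemma edist_ball (r : R) : [set x : 'rV[R]_m | edist x 0 <= r] `<=` [set x | `|x| <= r].
Proof. by move=> x /= xr; rewrite -[x]subr0 (le_trans (normB_le_edist _ _)). Qed.

Lemma compact_edist_ball (r : R) : compact [set x : 'rV[R]_m | edist x 0 <= r].
Proof.
apply: bounded_closed_compact.
  exists r; split; first by rewrite num_real.
  by move=> M rM x /edist_ball /= xr; exact: le_trans (ltW rM).
move=> x clx /=; apply/ler_addgt0Pr => e e0.
have /clx[y [/= yr xy]] := near_edist x e0.
by rewrite (le_trans (edist_triangle y _ _))// addrC lerD// ltW.
Qed.

End euclidean_distance.

(** * One-sided and two-sided Hausdorff distances *)

Section excess.
Context {R : realType} {m : nat}.
Implicit Types (x y : 'rV[R]_m) (A B C : set 'rV[R]_m).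
Local Open Scope ereal_scope.

(** The one-sided Hausdorff distance. Unlike [hausdorff] it is monotone, increasing in [A] and
    decreasing in [B], and most estimates on cuts rest on this. *)
Definition excess A B : \bar R :=
  ereal_sup [set ereal_inf [set (edist a b)%:E | b in B] | a in A].

Lemma hausdorffE A B : hausdorff A B = maxe (excess A B) (excess B A).
Proof.
rewrite /hausdorff /excess; congr (maxe _ (ereal_sup _)).
apply: eq_imagel => b _; congr ereal_inf.
by apply: eq_imagel => a _; rewrite edistC.
Qed.

Lemma excess_leP A B (r : \bar R) :
  excess A B <= r <->
  (forall a, A a -> ereal_inf [set (edist a b)%:E | b in B] <= r).
Proof.
split=> [AB a Aa|AB].
  by apply: le_trans AB; apply: ereal_sup_ubound; exists a.
by apply: ge_ereal_sup => _ [a Aa <-]; exact: AB.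
Qed.

Lemma excess_le A B (r : R) :
  (forall a, A a -> exists2 b, B b & (edist a b <= r)%R) -> excess A B <= r%:E.
Proof.
move=> AB; apply/excess_leP => a /AB[b Bb abr].
by apply: ge_ereal_inf; exists (edist a b)%:E; [exists b|rewrite lee_fin].
Qed.

Lemma excess_lt A B (r : \bar R) : excess A B < r ->
  forall a, A a -> exists2 b, B b & (edist a b)%:E < r.
Proof.
move=> ABr a Aa; have : ereal_inf [set (edist a b)%:E | b in B] < r.
  by apply: le_lt_trans ABr; apply: ereal_sup_ubound; exists a.
by move=> /ereal_inf_lt[_ [b Bb <-] abr]; exists b.
Qed.

(** A supremum over an empty [A] would be [-oo]. An empty [B] is harmless, since it gives infima
    equal to [+oo]. *)
Lemma excess_ge0 A B : A !=set0 -> 0 <= excess A B.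
Proof.
move=> [a Aa]; apply: le_ereal_sup_tmp.
exists (ereal_inf [set (edist a b)%:E | b in B]); first by exists a.
by apply: le_ereal_inf_tmp => _ [b _ <-]; rewrite lee_fin edist_ge0.
Qed.

Lemma excessS A A' B B' : A `<=` A' -> B' `<=` B ->
  excess A B <= excess A' B'.
Proof.
move=> AA BB; apply/excess_leP => a /AA A'a.
have /excess_leP/(_ _ A'a) := lexx (excess A' B'); apply: le_trans.
by apply: ereal_inf_le_tmp => _ [b /BB Bb <-]; exists b.
Qed.

Lemma excess_sub A B : A `<=` B -> excess A B <= 0.
Proof. by move=> AB; apply: excess_le => a /AB Ba; exists a; rewrite ?edistxx. Qed.

(** With [B] empty the right-hand side could be [+oo] plus [-oo], which is [-oo]. Infinite terms are
    discharged first; for finite ones the strict bounds [excess < excess + e / 2] yield intermediate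
    points. *)
Lemma excess_triangle B A C : B !=set0 -> excess A C <= excess A B + excess B C.
Proof.
move=> B0; have := excess_ge0 C B0.
have [->|BCy BC0] := eqVneq (excess B C) +oo.
  have [[a Aa] _|A0 _] := pselect (A !=set0).
    by rewrite addey ?leey// gt_eqF// (lt_le_trans _ (excess_ge0 _ _))//; exists a.
  by apply/excess_leP => a Aa; case: A0; exists a.
have [ABy|ABy] := eqVneq (excess A B) +oo.
  by rewrite ABy addye ?leey// gt_eqF// (lt_le_trans _ BC0).
apply/excess_leP => a Aa; apply/lee_addgt0Pr => e e0.
have BCf : excess B C \is a fin_num by rewrite ge0_fin_numE// ltey.
have ABf : excess A B \is a fin_num.
  by rewrite ge0_fin_numE ?ltey// excess_ge0//; exists a.
have e20 : 0 < (e / 2)%:E by rewrite lte_fin divr_gt0.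
have ABe : excess A B < excess A B + (e / 2)%:E by rewrite lteDl.
have BCe : excess B C < excess B C + (e / 2)%:E by rewrite lteDl.
have [b Bb ab] := excess_lt ABe Aa.
have [c Cc bc] := excess_lt BCe Bb.
apply: ge_ereal_inf; exists (edist a c)%:E; first by exists c.
apply: (@le_trans _ _ ((edist a b)%:E + (edist b c)%:E)).
  by rewrite -EFinD lee_fin edist_triangle.
by rewrite (splitr e) EFinD addeACA leeD// ltW.
Qed.

Lemma hausdorff_ge0 A B : A !=set0 -> 0 <= hausdorff A B.
Proof. by move=> A0; rewrite hausdorffE le_max excess_ge0. Qed.

Lemma hausdorffC A B : hausdorff A B = hausdorff B A.
Proof. by rewrite !hausdorffE maxC. Qed.

Lemma excess_le_hausdorff A B : excess A B <= hausdorff A B.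
Proof. by rewrite hausdorffE le_max lexx. Qed.

Lemma hausdorff_nested A B : B !=set0 -> B `<=` A ->
  hausdorff A B = excess A B.
Proof.
move=> B0 BA; rewrite hausdorffE; apply/max_idPl.
apply: le_trans (excess_sub BA) _; apply: excess_ge0.
by case: B0 => b /BA Ab; exists b.
Qed.

Lemma hausdorff_triangle B A C : A !=set0 -> B !=set0 -> C !=set0 ->
  hausdorff A C <= hausdorff A B + hausdorff B C.
Proof.
move=> A0 B0 C0; rewrite hausdorffE ge_max; apply/andP; split.
  by apply: le_trans (excess_triangle _ _ B0) _; rewrite leeD// excess_le_hausdorff.
apply: le_trans (excess_triangle _ _ B0) _.
by rewrite addeC leeD// hausdorffC excess_le_hausdorff.
Qed.

End excess.

(** * Cuts at positive levels and their left continuity *)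

Section compact_cuts.
Context {R : realType} {m : nat}.
Implicit Types (x y : 'rV[R]_m) (u v : 'rV[R]_m -> R) (a b h : R).

(** The working substitute for membership in F_B^p. Only positive levels occur, because the [0]-cut
    of an element of F_B^p may be unbounded. *)
Definition compact_cuts u := fuzzy_usc u /\
  forall a, 0 < a <= 1 -> compact (cut u a) /\ cut u a !=set0.

Lemma cut_gt0 u a : 0 < a -> cut u a = [set x | a <= u x].
Proof. by rewrite /cut => ->. Qed.

Lemma cut_subset u a b : 0 < a -> a <= b -> cut u b `<=` cut u a.
Proof.
move=> a0 ab; rewrite !cut_gt0// ?(lt_le_trans a0)// => x /=; exact: le_trans.
Qed.

Lemma usc_near u x a : fuzzy_usc u -> u x < a -> \forall y \near x, u y < a.
Proof.
move=> uscu uxa; have := uscu x (- a); rewrite lte_fin ltrN2 => /(_ uxa)[V xV VP].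
by apply: filterS xV => y /VP; rewrite lte_fin ltrN2.
Qed.

Lemma cut_closed u a : fuzzy_usc u -> 0 < a -> closed (cut u a).
Proof.
move=> uscu a0; rewrite cut_gt0// => x clx /=; rewrite leNgt; apply/negP => uxa.
by have [y [/= ay]] := clx _ (usc_near uscu uxa); rewrite ltNge ay.
Qed.

(** A compactness argument in the cut at [a / 2]: near a point of the cut at [a] there is nothing to
    do, and near any other point [u] stays below some [c < a], so that this neighbourhood misses the
    cuts at all levels [b > c]. *)
Lemma cut_left_continuous u a (e : R) : compact_cuts u -> 0 < a <= 1 -> 0 < e ->
  exists2 b, 0 < b < a & (excess (cut u b) (cut u a) <= e%:E)%E.
Proof.
move=> [uscu cu] /andP[a0 a1] e0.
have a20 : 0 < a / 2 by rewrite divr_gt0.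
have a2a : a / 2 < a by rewrite ltr_pdivrMr// ltr_pMr// ltr1n.
have [] := cu (a / 2); first by rewrite a20 (le_trans (ltW a2a)).
move=> /compact_near_coveringP cov _.
have H : \forall b \near at_left a, cut u (a / 2) `<=`
    (fun x => cut u b x -> exists2 y, cut u a y & edist x y <= e).
  apply: cov => x _; have [xa|xa] := pselect (cut u a x).
    exists ([set x' | edist x x' < e], setT); first by split; [exact: near_edist|exact: filterT].
    by move=> [x' b] /= [xx' _] _; exists x => //; rewrite edistC ltW.
  move: xa; rewrite cut_gt0//= => /negP; rewrite -ltNge => uxa.
  pose c := (u x + a) / 2.
  have uxc : u x < c by rewrite midf_lt.
  have ca : c < a by rewrite midf_lt.
  (* The maximum with [0] keeps [b] positive, where [cut] is a superlevel set and not a closure. *)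
  exists ([set x' | u x' < c], [set b | Num.max 0 c < b]).
    split => /=; first exact: usc_near.
    by apply: nbhs_left_gt; rewrite gt_max a0.
  move=> [x' b] /= [x'c]; rewrite gt_max => /andP[b0 cb].
  by rewrite cut_gt0//= leNgt (lt_trans x'c).
have : \forall b \near at_left a, a / 2 < b < a /\ cut u (a / 2) `<=`
    (fun x => cut u b x -> exists2 y, cut u a y & edist x y <= e).
  near=> b; split; last by near: b.
  by apply/andP; split; near: b; [exact: nbhs_left_gt|exact: nbhs_left_lt].
move=> /filter_ex[b [/andP[a2b ba] sub]]; exists b.
  by rewrite ba (lt_trans a20).
apply: excess_le => x bx; apply: (sub) => //.
by apply: cut_subset bx => //; exact: ltW.
Unshelve. all: by end_near. Qed.

End compact_cuts.

(** * Measurability of the Hausdorff distances as functions of the level *)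

Section measurability.
Context {R : realType} {m : nat}.
Implicit Types (u v : 'rV[R]_m -> R) (A B : R -> set 'rV[R]_m).

(* Every rational [q < a] gives [excess (A a) (B q) <= excess (A a) (B a)], with
   equality in the supremum over [q] by left continuity, and the superlevel sets
   of [excess (A _) (B q)] are intervals. *)
Lemma measurable_excess (h k : R) A B :
  (forall s t, h < s -> s <= t -> t <= k -> A t `<=` A s) ->
  (forall s t, h < s -> s <= t -> t <= k -> B t `<=` B s) ->
  (forall t, h < t <= k -> B t !=set0) ->
  (forall t (e : R), h < t <= k -> 0 < e ->
     exists2 s, h < s < t & (excess (B s) (B t) <= e%:E)%E) ->
  measurable_fun `]h, k] ((fun t => excess (A t) (B t)) : R -> \bar R).
Proof.
move=> dA dB B0 lB; apply: (measurability (@ErealGenOInfty.G R)).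
  exact: ErealGenOInfty.measurableE.
move=> _ [_ [r ->] <-].
pose E (q : rat) : set R := if h < ratr q then
  `]ratr q, k]%classic `&` [set t | (r%:E < excess (A t) (B (ratr q)))%E] else set0.
rewrite [X in measurable X](_ : _ = \bigcup_q E q).
  apply: bigcupT_measurable_rat => q; rewrite /E; case: ifPn => // hq.
  apply: is_interval_measurable => s t /=; rewrite !in_itv/= ?andbT.
  move=> [/andP[qs sk] rs] [/andP[qt tk] rt] w /andP[sw wt].
  rewrite in_itv/= (lt_le_trans qs sw) (le_trans wt tk); split => //.
  by apply: lt_le_trans rt _; apply: excessS => //; apply: dA => //;
    apply: lt_trans hq _; apply: lt_le_trans sw.
apply/seteqP; split => [t/=|t [q _]].
  rewrite !in_itv/= ?andbT => -[/andP[ht tk] rt].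
  apply: contrapT => nE; move: rt; apply/negP; rewrite -leNgt.
  apply/lee_addgt0Pr => e e0.
  have [|s /andP[hs st] se] := lB t e _ e0; first by rewrite ht.
  have [q] := rat_in_itvoo st; rewrite in_itv/= => /andP[sq qt].
  have hq := lt_trans hs sq.
  have qe : (excess (B (ratr q)) (B t) <= e%:E)%E.
    by apply: le_trans se; apply: excessS => //; apply: dB (ltW sq) _ => //;
      exact: ltW (lt_le_trans qt tk).
  apply: (le_trans (excess_triangle (A t) (B t) (B0 (ratr q) _))).
    by rewrite hq ltW// (lt_le_trans qt).
  apply: leeD => //; rewrite leNgt; apply/negP => rq; apply: nE; exists q => //.
  by rewrite /E hq; split => //=; rewrite in_itv/= qt.
rewrite /E; case: ifPn => // hq [/=]; rewrite !in_itv/= ?andbT => /andP[qt tk] rt.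
split; first by rewrite (lt_trans hq).
by apply: lt_le_trans rt _; apply: excessS => //; apply: dB => //; exact: ltW.
Qed.

Definition cut_dist u v (a : R) : \bar R := hausdorff (cut u a) (cut v a).

Definition cut_gap (h : R) u (a : R) : \bar R :=
  hausdorff (cut u a) (cut u (a - h)).

Lemma measurable_cut_dist u v : compact_cuts u -> compact_cuts v ->
  measurable_fun `](0 : R), 1] (cut_dist u v).
Proof.
move=> cu cv; have -> : cut_dist u v = fun a =>
    maxe (excess (cut u a) (cut v a)) (excess (cut v a) (cut u a)).
  by apply/funext => a; rewrite -hausdorffE.
by apply: measurable_maxe; apply: measurable_excess;
  do ?[by move=> *; exact: cut_subset | by move=> *; exact: cut_left_continuous];
  [move=> t /cv.2[] | move=> t /cu.2[]].
Qed.

Lemma measurable_cut_gap u (h : R) : 0 <= h -> compact_cuts u ->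
  measurable_fun `]h, 1] (cut_gap h u).
Proof.
move=> h0 cu; have -> : cut_gap h u = fun a =>
    maxe (excess (cut u a) (cut u (a - h))) (excess (cut u (a - h)) (cut u a)).
  by apply/funext => a; rewrite -hausdorffE.
have sub s t : h < s -> s <= t -> t <= 1 -> cut u (t - h) `<=` cut u (s - h).
  by move=> hs st t1; apply: cut_subset; rewrite ?subr_gt0// lerD2r.
have sub' s t : h < s -> s <= t -> t <= 1 -> cut u t `<=` cut u s.
  by move=> hs st t1; apply: cut_subset => //; exact: le_lt_trans hs.
have cth t : h < t <= 1 -> 0 < t - h <= 1.
  by rewrite subr_gt0 => /andP[-> t1]; rewrite lerBlDr (le_trans t1)// lerDl.
have ct t : h < t <= 1 -> 0 < t <= 1.
  by move=> /andP[ht ->]; rewrite (le_lt_trans h0).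
apply: measurable_maxe; apply: measurable_excess => //.
- by move=> t /cth /cu.2[].
- move=> t e /cth tht e0; have [s /andP[s0 st] se] := cut_left_continuous cu tht e0.
  exists (s + h); first by rewrite ltrDr s0 -ltrBrDr.
  by rewrite addrK.
- by move=> t /ct /cu.2[].
- move=> t e ht e0; have [s /andP[s0 st] se] := cut_left_continuous cu (ct _ ht) e0.
  move: (ht) => /andP[ltht t1].
  (* The level [s] only satisfies [0 < s < t]; the midpoint brings the witness above [h]. *)
  exists (Num.max s ((h + t) / 2)).
    by rewrite lt_max gt_max st !midf_lt ?orbT.
  apply: le_trans se; apply: excessS => //.
  by apply: cut_subset => //; rewrite le_max lexx.
Qed.

Lemma cut_zerohat (a : R) : 0 < a <= 1 -> cut zerohat a = [set 0 : 'rV[R]_m].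
Proof.
move=> /andP[a0 a1]; rewrite cut_gt0//; apply/seteqP; split => x /=.
  by rewrite /zerohat indicE; have [//|x0] := pselect (x = 0); rewrite memNset// leNgt a0.
by move=> ->; rewrite /zerohat indicE mem_set.
Qed.

Lemma compact_cuts_zerohat : compact_cuts (zerohat : 'rV[R]_m -> R).
Proof.
split; last first.
  by move=> a /cut_zerohat ->; split; [exact: compact_set1|exists 0].
move=> x a; rewrite lte_fin /zerohat indicE; have [->|x0] := eqVneq x 0.
  rewrite mem_set//= => a1; exists setT; first exact: filterT.
  move=> y _; rewrite lte_fin; apply: (lt_le_trans a1).
  by rewrite lerN2 indicE; case: (_ \in _).
rewrite memNset/= => [|/eqP]; last by rewrite (negbTE x0).
move=> a0; exists [set y | edist x y < `|x|].
  by apply: near_edist; rewrite normr_gt0.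
move=> y /= xy; rewrite lte_fin indicE memNset//= => y0; move: xy.
by rewrite y0 ltNge -[X in `|X|]subr0 normB_le_edist.
Qed.

End measurability.

(** * Integrals of p-th powers of nonnegative functions *)

Section nonneg_integrals.
Local Open Scope ereal_scope.
Context d (T : measurableType d) (R : realType).
Variable mu : {measure set T -> \bar R}.
Implicit Types (D : set T) (f g : T -> \bar R) (p : R).

(* The integral of a nonnegative function is a supremum over simple functions
   below it, so that monotonicity needs no measurability. *)
Lemma ge0_le_integral_nomeas D f g : (forall x, D x -> 0 <= f x) ->
  (forall x, D x -> f x <= g x) ->
  \int[mu]_(x in D) f x <= \int[mu]_(x in D) g x.
Proof.
move=> f0 fg; rewrite integral_mkcond ge0_integralTE; last first.
  by move=> x; rewrite patchE; case: ifPn => // /set_mem; exact: f0.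
rewrite [leRHS]integral_mkcond ge0_integralTE; last first.
  move=> x; rewrite patchE; case: ifPn => // /set_mem Dx.
  exact: le_trans (f0 _ Dx) (fg _ Dx).
apply: ereal_sup_le => _ [h hle <-]; exists h => // x.
apply: le_trans (hle x) _; rewrite !patchE.
by case: ifPn => // /set_mem; exact: fg.
Qed.

Lemma le_poweR p (x y : \bar R) : (0 <= p)%R -> 0 <= x -> x <= y ->
  x `^ p <= y `^ p.
Proof.
by move=> p0 x0 xy; apply: gt0_ler_poweR; rewrite ?in_itv/= ?leey ?andbT// (le_trans x0).
Qed.

(** The sum is at most three times its largest term, whose power is one of the three on the right.
    The crude constant [3 ^ p] suffices, as only smallness is at stake. *)
Lemma poweRD3_le p (x y z : \bar R) : (0 <= p)%R -> 0 <= x -> 0 <= y -> 0 <= z ->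
  (x + y + z) `^ p <= (3 `^ p)%:E * (x `^ p + y `^ p + z `^ p).
Proof.
move=> p0 x0 y0 z0; pose M := maxe x (maxe y z).
have xM : x <= M by rewrite le_max lexx.
have yM : y <= M by rewrite !le_max lexx orbT.
have zM : z <= M by rewrite !le_max lexx !orbT.
have M0 : 0 <= M by exact: le_trans xM.
apply: (@le_trans _ _ ((3%:E * M) `^ p)).
  apply: le_poweR => //; first by rewrite !adde_ge0.
  have -> : 3%:E = 1 + 1 + 1 :> \bar R by rewrite -!EFinD; congr EFin; ring.
  by rewrite ge0_muleDl ?adde_ge0 ?lee_fin// ge0_muleDl ?lee_fin// !mul1e !leeD.
rewrite poweRM// -poweR_EFin lee_wpmul2l ?poweR_ge0//.
have q0 (t : \bar R) : 0 <= t `^ p by exact: poweR_ge0.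
have : [\/ M = x, M = y | M = z].
  rewrite /M; have [xyz|xyz] := leP x (maxe y z).
    by have [yz|yz] := leP y z; [apply: Or33|apply: Or32].
  by apply: Or31.
case=> ->; first by rewrite -addeA leeDl// adde_ge0.
  by rewrite -addeA addeCA leeDl// adde_ge0.
by rewrite leeDr// adde_ge0.
Qed.

Lemma measurable_fun_poweR D f p : measurable_fun D f ->
  measurable_fun D (fun x => f x `^ p).
Proof. by move=> mf; exact: (measurableT_comp (measurable_poweR p) mf). Qed.

(** The form in which triangle inequalities between cuts are integrated. Where two summands are
    enough, the third is taken to be the constant [0]. *)
Lemma integral_poweRD3_le D p f (g1 g2 g3 : T -> \bar R) : (0 <= p)%R ->
  measurable D -> measurable_fun D g1 -> measurable_fun D g2 ->
  measurable_fun D g3 ->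
  (forall x, D x -> 0 <= f x) -> (forall x, D x -> 0 <= g1 x) ->
  (forall x, D x -> 0 <= g2 x) -> (forall x, D x -> 0 <= g3 x) ->
  (forall x, D x -> f x <= g1 x + g2 x + g3 x) ->
  \int[mu]_(x in D) f x `^ p <= (3 `^ p)%:E * (\int[mu]_(x in D) g1 x `^ p +
    \int[mu]_(x in D) g2 x `^ p + \int[mu]_(x in D) g3 x `^ p).
Proof.
move=> p0 mD m1 m2 m3 f0 g10 g20 g30 fg.
have q0 (t : \bar R) : 0 <= t `^ p by exact: poweR_ge0.
rewrite -ge0_integralD//; try exact: measurable_fun_poweR.
rewrite -ge0_integralD//; try exact: measurable_fun_poweR; last 2 first.
  by move=> x _; rewrite adde_ge0.
  by apply: emeasurable_funD; exact: measurable_fun_poweR.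
rewrite -ge0_integralZl_EFin ?powR_ge0//; last 2 first.
  by move=> x _; rewrite !adde_ge0.
  by do 2?apply: emeasurable_funD; exact: measurable_fun_poweR.
apply: ge0_le_integral_nomeas => // x Dx.
apply: le_trans (poweRD3_le p0 (g10 _ Dx) (g20 _ Dx) (g30 _ Dx)).
by apply: le_poweR; rewrite ?f0 ?fg.
Qed.

(** The estimates are carried out on integrals of p-th powers; this lemma and the next translate
    bounds on p-th roots into bounds on them. *)
Lemma poweRV_lt (p e : R) (x : \bar R) : (0 < p)%R -> (0 < e)%R -> 0 <= x ->
  (x `^ p^-1 < e%:E) = (x < (e `^ p)%:E).
Proof.
move=> p0 e0 x0; have pN0 : p != 0%R by rewrite gt_eqF.
have xE : x = (x `^ p^-1) `^ p by rewrite -poweRrM mulVf// poweRe1.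
have eE : e%:E = ((e `^ p)%:E) `^ p^-1.
  by rewrite poweR_EFin -powRrM mulfV// powRr1// ltW.
apply/idP/idP; rewrite !ltNge; apply: contra => h.
  by rewrite eE; apply: le_poweR => //; rewrite ?lee_fin ?powR_ge0 ?invr_ge0 ?(ltW p0).
by rewrite xE -poweR_EFin; apply: le_poweR => //; rewrite ?lee_fin ltW.
Qed.

Lemma poweRV_le (p e : R) (x : \bar R) : (0 < p)%R -> (0 <= e)%R -> 0 <= x ->
  (x `^ p^-1 <= e%:E) = (x <= (e `^ p)%:E).
Proof.
move=> p0 e0 x0; have pN0 : p != 0%R by rewrite gt_eqF.
have xE : x = (x `^ p^-1) `^ p by rewrite -poweRrM mulVf// poweRe1.
have eE : e%:E = ((e `^ p)%:E) `^ p^-1.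
  by rewrite poweR_EFin -powRrM mulfV// powRr1.
apply/idP/idP => h.
  by rewrite xE -poweR_EFin; apply: le_poweR; rewrite ?poweR_ge0 ?(ltW p0).
by rewrite eE; apply: le_poweR; rewrite ?invr_ge0 ?(ltW p0).
Qed.

End nonneg_integrals.

(** * Translations and constant bounds for Lebesgue integrals *)

Section lebesgue_integrals.
Local Open Scope ereal_scope.
Context {R : realType}.
Local Notation mu := (@lebesgue_measure R).
Implicit Types (f : R -> \bar R) (a b c h p : R).

(** By uniqueness of Lebesgue measure it is enough to compare half-open intervals, whose length a
    translation preserves. *)
Lemma lebesgue_measure_shift h (A : set R) : measurable A ->
  pushforward mu (fun x : measurableTypeR R => (x + h)%R : measurableTypeR R) A = mu A.
Proof.
have ms : measurable_fun setT (fun x : measurableTypeR R => (x + h)%R : measurableTypeR R).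
  exact: measurable_funD.
move=> mA; apply/esym/lebesgue_measure_unique => //= _ [[a b]] _ <-.
rewrite /pushforward /=.
have -> : (fun x : R => (x + h)%R) @^-1` `]a, b] = `](a - h)%R, (b - h)%R]%classic.
  by apply/seteqP; split => x /=; rewrite !in_itv/= ltrBlDr lerBrDr.
by rewrite !lebesgue_measure_itv/= !lte_fin ltrD2r; case: ifPn => // _;
  rewrite -!EFinB opprB addrA subrK.
Qed.

Lemma ge0_integral_shift f h a b : measurable_fun `](a + h)%R, (b + h)%R] f ->
  (forall x, `](a + h)%R, (b + h)%R]%classic x -> 0 <= f x) ->
  \int[mu]_(x in `]a, b]) f (x + h)%R = \int[mu]_(x in `](a + h)%R, (b + h)%R]) f x.
Proof.
move=> mf f0.
have ms : measurable_fun setT (fun x : measurableTypeR R => (x + h)%R : measurableTypeR R).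
  exact: measurable_funD.
have -> : `]a, b]%classic = (fun x : measurableTypeR R => (x + h)%R : measurableTypeR R)
    @^-1` `](a + h)%R, (b + h)%R].
  by apply/seteqP; split => x /=; rewrite !in_itv/= ltrD2r lerD2r.
rewrite -(ge0_integral_pushforward ms)//=; last by move=> x /set_mem; exact: f0.
by apply: eq_measure_integral => //= A mA _; exact: lebesgue_measure_shift.
Qed.

Lemma integral_cst_itv (r : \bar R) a b : (a <= b)%R -> 0 <= r ->
  \int[mu]_(x in `]a, b]) r = r * (b - a)%:E.
Proof.
move=> ab r0; rewrite integral_cst//= lebesgue_measure_itv/= lte_fin.
case: ltP => [_|ba]; first by rewrite EFinB.
by rewrite (@le_anti _ _ a b) ?ab// subrr.
Qed.

Lemma integral_cst_poweR (r p a b : R) : (a <= b)%R ->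
  \int[mu]_(x in `]a, b]) (cst r%:E x) `^ p = (r `^ p * (b - a))%:E.
Proof.
by move=> ab; rewrite EFinM -poweR_EFin -(integral_cst_itv ab (poweR_ge0 _ _)).
Qed.

(** A Chebyshev-type bound: it will confine each positive cut to a ball and show that [d_ p]
    separates points. *)
Lemma integral_ge_cst (D : set R) f (r : \bar R) a b : (a <= b)%R ->
  `]a, b]%classic `<=` D -> (forall x, D x -> 0 <= f x) -> 0 <= r ->
  (forall x, (a < x <= b)%R -> r <= f x) ->
  r * (b - a)%:E <= \int[mu]_(x in D) f x.
Proof.
move=> ab abD f0 r0 rf; rewrite -integral_cst_itv//.
rewrite integral_mkcond [leRHS]integral_mkcond.
apply: ge0_le_integral_nomeas => x _; first exact: erestrict_ge0.
rewrite !patchE; case: ifPn => [/set_mem xab|_].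
  by rewrite mem_set; [exact: rf|exact: abD].
by case: ifPn => // /set_mem; exact: f0.
Qed.

End lebesgue_integrals.

(** * Excess between bounded sets, and distance to a closed set *)

Section bounded_excess.
Context {R : realType} {m : nat}.
Implicit Types (x y : 'rV[R]_m) (A B : set 'rV[R]_m).
Local Open Scope ereal_scope.

Lemma excess0_le A (r : R) : excess A [set 0%R] <= r%:E ->
  forall x, A x -> (edist x 0 <= r)%R.
Proof.
move=> Ar x Ax; rewrite -lee_fin; apply: le_trans Ar.
apply: ereal_sup_ubound; exists x => //.
by rewrite image_set1 ereal_inf1.
Qed.

Lemma excess_finite A B (r s : R) : A !=set0 -> B !=set0 ->
  (forall x, A x -> (edist x 0 <= r)%R) -> (forall x, B x -> (edist x 0 <= s)%R) ->
  excess A B <= (r + s)%:E.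
Proof.
move=> A0 [b Bb] Ar Bs; apply: excess_le => a Aa; exists b => //.
by rewrite (le_trans (edist_triangle 0 _ _))// lerD ?Ar// edistC Bs.
Qed.

Lemma closed_edist_gt0 A x : closed A -> ~ A x ->
  exists2 e : R, (0 < e)%R & forall y, A y -> (e <= edist x y)%R.
Proof.
move=> cA nAx; have : \forall y \near x, (~` A) y.
  by apply: open_nbhs_nbhs; split => //; exact: closed_openC.
move=> /nbhs_ballP[e /= e0 eA]; exists e => // y Ay; rewrite leNgt; apply/negP => xy.
have : ball x e y.
  by rewrite -ball_normE /=; exact: le_lt_trans (normB_le_edist _ _) xy.
by move=> /eA.
Qed.

Lemma compact_edist_bounded A : compact A ->
  exists r : R, forall x, A x -> (edist x 0 <= r)%R.
Proof.
move=> /compact_bounded[M [_ MA]]; exists (Num.sqrt m%:R * (M + 1))%R => x Ax.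
apply: le_trans (edist_le_normB _ _) _; rewrite ler_wpM2l ?sqrtr_ge0//.
by rewrite subr0; apply: MA Ax; rewrite ltrDl.
Qed.

End bounded_excess.

(** * The distance [d_ p] and the cuts of elements of F_B^p *)

Section dp_distance.
Context {R : realType} {m : nat}.
Implicit Types (x y : 'rV[R]_m) (u v w : 'rV[R]_m -> R) (a p h : R).
Local Open Scope ereal_scope.
Local Notation mu := (@lebesgue_measure R).

(** The p-th power of [d_ p]. The interval is open at [0], a null set, so that only compact cuts
    occur; [Gp] is likewise open at [h], where the level [a - h] would be [0]. *)
Definition Dp p u v := \int[mu]_(a in `]0%R, 1%R]) cut_dist u v a `^ p.

Definition Gp p h u := \int[mu]_(a in `]h, 1%R]) cut_gap h u a `^ p.

Lemma in_itv01 a : (`]0%R, 1%R]%classic a) = (0 < a <= 1)%R.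
Proof. by rewrite /= in_itv. Qed.

Lemma Dp_ge0 p u v : 0 <= Dp p u v.
Proof. by apply: integral_ge0 => a _; exact: poweR_ge0. Qed.

Lemma Gp_ge0 p h u : 0 <= Gp p h u.
Proof. by apply: integral_ge0 => a _; exact: poweR_ge0. Qed.

Lemma d_E p u v : compact_cuts u -> compact_cuts v ->
  d_ p u v = Dp p u v `^ p^-1.
Proof.
move=> cu cv; rewrite /d_ /Dp integral_itv_obnd_cbnd//.
by apply: measurable_fun_poweR; exact: measurable_cut_dist.
Qed.

Lemma cut_distC u v : cut_dist u v = cut_dist v u.
Proof. by apply/funext => a; rewrite /cut_dist hausdorffC. Qed.

Lemma d_ge0 p u v : 0 <= d_ p u v.
Proof. exact: poweR_ge0. Qed.

Lemma d_C p u v : d_ p u v = d_ p v u.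
Proof.
by rewrite /d_; under eq_integral do rewrite hausdorffC.
Qed.

Lemma d_xx p u : (0 < p)%R -> compact_cuts u -> d_ p u u = 0.
Proof.
move=> p0 cu; rewrite d_E// /Dp integral0_eq ?poweR0r ?invr_neq0 ?gt_eqF// => a.
rewrite in_itv01 => /cu.2[_ a0]; rewrite /cut_dist hausdorff_nested//.
have -> : excess (cut u a) (cut u a) = 0.
  by apply/le_anti; rewrite excess_sub// excess_ge0.
by rewrite poweR0r ?gt_eqF.
Qed.

Lemma cut_dist_ge0 u v a : compact_cuts u -> (0 < a <= 1)%R -> 0 <= cut_dist u v a.
Proof. by move=> cu /cu.2[_ u0]; exact: hausdorff_ge0. Qed.

Lemma cut_dist_fin u v a : compact_cuts u -> compact_cuts v -> (0 < a <= 1)%R ->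
  cut_dist u v a \is a fin_num.
Proof.
move=> cu cv a01; rewrite ge0_fin_numE ?cut_dist_ge0//.
have [/compact_edist_bounded[r ur] u0] := cu.2 _ a01.
have [/compact_edist_bounded[s vs] v0] := cv.2 _ a01.
rewrite /cut_dist hausdorffE gt_max.
by rewrite !(le_lt_trans (excess_finite _ _ ur vs),
  le_lt_trans (excess_finite _ _ vs ur))// ltry.
Qed.

Lemma cut_dist_triangle u v w a : compact_cuts u -> compact_cuts v ->
  compact_cuts w -> (0 < a <= 1)%R ->
  cut_dist u w a <= cut_dist u v a + cut_dist v w a.
Proof.
move=> cu cv cw a01; apply: hausdorff_triangle.
- exact: (cu.2 _ a01).2.
- exact: (cv.2 _ a01).2.
- exact: (cw.2 _ a01).2.
Qed.

Lemma cut_dist_zerohat u a : (0 < a <= 1)%R ->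
  cut_dist u zerohat a = hausdorff (cut u a) [set 0%R].
Proof. by move=> a01; rewrite /cut_dist cut_zerohat. Qed.

Lemma d_triangle p v u w : (1 <= p)%R ->
  compact_cuts u -> compact_cuts v -> compact_cuts w ->
  d_ p u w <= d_ p u v + d_ p v w.
Proof.
move=> p1 cu cv cw; have p0 : (0 < p)%R by exact: lt_le_trans p1.
(* Minkowski's inequality is used for real functions on the whole line, so the distance between
   cuts, finite on []0, 1]], is made real there and extended by [0]. *)
pose f u v : R -> R := (fine \o cut_dist u v) \_ `]0%R, 1%R].
have mf s t : compact_cuts s -> compact_cuts t -> measurable_fun setT (f s t).
  move=> cs ct; apply: (measurable_restrictT _ _).1 => //.
  exact: (measurableT_comp (fine_measurable measurableT) (measurable_cut_dist cs ct)).
have f0 s t a : compact_cuts s -> (0 <= f s t a)%R.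
  move=> cs; rewrite /f patchE; case: ifPn => // /set_mem; rewrite in_itv01 => a01.
  by rewrite fine_ge0 ?cut_dist_ge0.
have NE s t : compact_cuts s -> compact_cuts t ->
    d_ p s t = Lnorm mu p%:E (EFin \o f s t).
  move=> cs ct; rewrite d_E// unlock; congr (_ `^ _).
  rewrite /Dp [LHS]integral_mkcond; apply: eq_integral => a _.
  rewrite /= ger0_norm ?f0// /f !patchE; case: ifPn => [/set_mem|_].
    by rewrite in_itv01 => a01; rewrite /= -fine_poweR fineK// fin_num_poweR// cut_dist_fin.
  by rewrite powR0 ?gt_eqF.
rewrite !NE//; have := minkowski_EFin mu (mf _ _ cu cv) (mf _ _ cv cw) p1.
apply: le_trans.
rewrite unlock; apply: le_poweR; first by rewrite invr_ge0 ltW.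
  by apply: integral_ge0 => a _; exact: poweR_ge0.
apply: ge0_le_integral_nomeas => a _; first exact: poweR_ge0.
apply: le_poweR => //=; first exact: ltW.
rewrite lee_fin !ger0_norm ?addr_ge0 ?f0// /f !patchE.
case: ifPn => [/set_mem|_]; last by rewrite addr0.
rewrite in_itv01 => a01; rewrite -lee_fin EFinD !fineK ?cut_dist_fin//.
exact: cut_dist_triangle.
Qed.

(** If [v x < u x], pick [c] between the two values. For every level in []c, u x]] the point [x]
    lies in the cut of [u] and at distance at least some [e > 0] from the cut of [v], so the
    integral is at least [e ^ p * (u x - c)]. *)
Lemma d_eq0 p u v : (0 < p)%R -> compact_cuts u -> compact_cuts v ->
  fuzzy u -> fuzzy v -> d_ p u v = 0 -> u = v.
Proof.
move=> p0 cu cv fu fv.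
suff H u' v' : compact_cuts u' -> compact_cuts v' -> fuzzy u' -> fuzzy v' ->
    d_ p u' v' = 0 -> forall x, (u' x <= v' x)%R.
  move=> uv0; have vu0 : d_ p v u = 0 by rewrite (d_C p v u).
  apply/funext => x; apply/le_anti/andP; split.
    exact: (H u v cu cv fu fv uv0).
  exact: (H v u cv cu fv fu vu0).
move=> {cu cv fu fv u v} [uu cu] [uv cv] fu fv uv0 x; rewrite leNgt; apply/negP => vu.
have [c vc cux] : exists2 c, (v' x < c)%R & (c < u' x)%R.
  by exists ((v' x + u' x) / 2)%R; rewrite midf_lt.
have /andP[v0 _] := fv x; have /andP[_ u1] := fu x.
have c0 : (0 < c)%R by exact: le_lt_trans vc.
have [|e e0 ve] := closed_edist_gt0 (x := x) (cut_closed uv c0).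
  by rewrite cut_gt0//=; apply/negP; rewrite -ltNge.
have : (e `^ p)%:E * (u' x - c)%:E <= Dp p u' v'.
  apply: integral_ge_cst => //; first exact: ltW.
  - move=> a; rewrite /= !in_itv/= => /andP[ca au].
    by rewrite (lt_trans c0)// (le_trans au).
  - by move=> a _; exact: poweR_ge0.
  - by rewrite lee_fin powR_ge0.
  move=> a /andP[ca aux]; rewrite -poweR_EFin; apply: le_poweR; [exact: ltW|by rewrite lee_fin ltW|].
  apply: (@le_trans _ _ (excess (cut u' a) (cut v' a))); last exact: excess_le_hausdorff.
  apply: le_ereal_sup_tmp; exists (ereal_inf [set (edist x b)%:E | b in cut v' a]).
    by exists x => //; rewrite cut_gt0// (lt_trans c0).
  apply: le_ereal_inf_tmp => _ [y vy <-]; rewrite lee_fin; apply: ve.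
  by apply: cut_subset vy => //; exact: ltW.
move: uv0; rewrite d_E// => /(poweR_eq0_eq0 (Dp_ge0 _ _ _)) ->.
by rewrite -EFinM lee_fin leNgt mulr_gt0// ?powR_gt0// subr_gt0.
Qed.

Lemma cut_neq0 u a : fuzzy_normal u -> (a <= 1)%R -> cut u a !=set0.
Proof.
move=> [x ux1] a1; exists x; rewrite /cut; case: ifPn => _ /=; rewrite ?ux1//.
by apply: subset_closure; rewrite /= ux1.
Qed.

(** The cuts decrease with the level, so the excess at level [a] bounds the integrand from below on
    []0, a]]. *)
Lemma excess0_poweR_le p u a : (0 <= p)%R -> fuzzy_normal u -> (0 < a <= 1)%R ->
  excess (cut u a) [set 0%R] `^ p * a%:E <=
  \int[mu]_(t in `[0%R, 1%R]) hausdorff (cut u t) [set 0%R] `^ p.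
Proof.
move=> p0 nu /andP[a0 a1]; rewrite -[X in X%:E]subr0; apply: integral_ge_cst.
- exact: ltW.
- by move=> t; rewrite /= !in_itv/= => /andP[/ltW-> ta]; rewrite (le_trans ta).
- by move=> t _; exact: poweR_ge0.
- exact: poweR_ge0.
move=> t /andP[t0 ta]; apply: le_poweR => //.
  by apply: excess_ge0; exact: cut_neq0.
apply: le_trans (excess_le_hausdorff _ _); apply: excessS => //.
exact: cut_subset.
Qed.

(** Upper semicontinuity closes the cuts; the finite integral bounds each one by the preceding
    estimate. *)
Lemma FBp_compact_cuts p u : (1 <= p)%R -> in_FBp p u -> compact_cuts u.
Proof.
move=> p1 [fu nu uu ul]; have p0 : (0 < p)%R by exact: lt_le_trans p1.
split => // a /andP[a0 a1]; have u0 := cut_neq0 nu a1; split => //.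
move/lty_poweRy : ul => /(_ (invr_neq0 (lt0r_neq0 p0))) ul.
have : excess (cut u a) [set 0%R] < +oo.
  rewrite ltNge leye_eq; apply/eqP => uy; move: ul; apply/negP; rewrite -leNgt.
  have := @excess0_poweR_le p u a (ltW p0) nu _; rewrite a0 a1 => /(_ isT).
  by rewrite uy poweRyr ?gt_eqF// mulyr gtr0_sg// mul1e.
rewrite -ge0_fin_numE ?excess_ge0// => uf.
apply: (@subclosed_compact _ _ [set x | (edist x 0 <= fine (excess (cut u a) [set 0%R]))%R]).
- exact: cut_closed.
- exact: compact_edist_ball.
- by move=> x; apply: excess0_le; rewrite fineK.
Qed.

Lemma Dp_zerohatE p u : compact_cuts u ->
  \int[mu]_(t in `[0%R, 1%R]) hausdorff (cut u t) [set 0%R] `^ p =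
  Dp p u zerohat.
Proof.
move=> cu; rewrite -integral_itv_obnd_cbnd.
  by apply: eq_integral => a /set_mem; rewrite in_itv01 => a01; rewrite cut_dist_zerohat.
apply: measurable_fun_poweR.
apply: (eq_measurable_fun (cut_dist u zerohat)).
  by move=> a /set_mem; rewrite in_itv01 => a01; rewrite cut_dist_zerohat.
by apply: measurable_cut_dist => //; exact: compact_cuts_zerohat.
Qed.

Lemma FBp_zerohat_finite p u : (1 <= p)%R -> in_FBp p u -> d_ p u zerohat < +oo.
Proof.
move=> p1 FBu; have cu := FBp_compact_cuts p1 FBu.
by rewrite (d_E p cu compact_cuts_zerohat) -Dp_zerohatE//; case: FBu.
Qed.

End dp_distance.

(** * Integrals over short intervals next to [0] *)

Section small_intervals.
Local Open Scope ereal_scope.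
Context {R : realType}.
Local Notation mu := (@lebesgue_measure R).
Implicit Types (f : R -> \bar R) (a b c h e : R).

Lemma measurable_fun_shift f h a b :
  measurable_fun `](a + h)%R, (b + h)%R] f ->
  measurable_fun `]a, b] (fun x => f (x + h)%R).
Proof.
move=> mf.
have ms : measurable_fun `]a, b] (fun x : measurableTypeR R => (x + h)%R : measurableTypeR R).
  exact: measurable_funD.
apply: (measurable_comp (F := `](a + h)%R, (b + h)%R]%classic) _ _ mf ms) => //.
by move=> _ [x /= + <-]; rewrite !in_itv/= ltrD2r lerD2r.
Qed.

Lemma integral_itvS f a b c d : (c <= a)%R -> (b <= d)%R ->
  measurable_fun `]c, d] f -> (forall x, `]c, d]%classic x -> 0 <= f x) ->
  \int[mu]_(x in `]a, b]) f x <= \int[mu]_(x in `]c, d]) f x.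
Proof.
move=> ca bd mf f0; apply: ge0_subset_integral => //.
by move=> x; rewrite /= !in_itv/= => /andP[ax xb]; rewrite (le_lt_trans ca)// (le_trans xb).
Qed.

Lemma integral_itv_split f a b c : (a <= b)%R -> (b <= c)%R ->
  measurable_fun `]a, c] f -> (forall x, `]a, c]%classic x -> 0 <= f x) ->
  \int[mu]_(x in `]a, c]) f x =
  \int[mu]_(x in `]a, b]) f x + \int[mu]_(x in `]b, c]) f x.
Proof.
move=> ab bc mf f0.
have E : `]a, c]%classic = `]a, b]%classic `|` `]b, c]%classic.
  by rewrite -itv_bndbnd_setU// bnd_simp.
rewrite E ge0_integral_setU// -?E//.
apply/disj_setPS => x [] /=; rewrite !in_itv/= => /andP[_ xb] /andP[bx _].
by move: bx; rewrite ltNge xb.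
Qed.

Lemma cvg_integral_itv0 f : measurable_fun `](0 : R)%R, 1%R] f ->
  (forall x, `]0%R, 1%R]%classic x -> 0 <= f x) ->
  \int[mu]_(x in `]n.+1%:R^-1%R, 1%R]) f x @[n --> \oo] -->
  \int[mu]_(x in `]0%R, 1%R]) f x.
Proof.
move=> mf f0; pose F n : set R := `](n.+1%:R^-1)%R, 1%R]%classic.
have sF n : F n `<=` `]0%R, 1%R]%classic.
  move=> x; rewrite /F /= !in_itv/= => /andP[nx ->]; rewrite andbT.
  by apply: lt_trans nx; rewrite invr_gt0 ltr0n.
have -> : `]0%R, 1%R]%classic = \bigcup_n F n.
  apply/seteqP; split; last by move=> x [n _ /sF].
  move=> x /=; rewrite in_itv/= => /andP[x0 x1].
  have [n nx] : exists n, (n.+1%:R^-1 < x)%R.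
    exists (Num.truncn x^-1); rewrite -[ltRHS]invrK ltf_pV2 ?posrE ?invr_gt0//.
    by rewrite truncnS_gt.
  by exists n => //; rewrite /F /= in_itv/= nx.
apply: ge0_nondecreasing_set_cvg_integral.
- move=> n k nk; apply/subsetPset => x; rewrite /F /= !in_itv/= => /andP[nx ->].
  by rewrite andbT (le_lt_trans _ nx)// lef_pV2 ?posrE ?ltr0n// ler_nat ltnS.
- by move=> n; exact: measurable_itv.
- by move=> n; apply: measurable_funS mf => //; exact: sF.
- by move=> n x /sF; exact: f0.
Qed.

(** By monotone convergence some []1 / (n + 1), 1]] carries the whole finite integral up to [e];
    what is left on []0, 1 / (n + 1)]] is then at most [e]. *)
Lemma integral_itv0_small f e : measurable_fun `](0 : R)%R, 1%R] f ->
  (forall x, `]0%R, 1%R]%classic x -> 0 <= f x) ->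
  \int[mu]_(x in `]0%R, 1%R]) f x < +oo -> (0 < e)%R ->
  exists2 h, (0 < h <= 1)%R & \int[mu]_(x in `]0%R, h]) f x <= e%:E.
Proof.
move=> mf f0 foo e0; set I := \int[mu]_(x in `]0%R, 1%R]) f x.
have If : I \is a fin_num by rewrite ge0_fin_numE// integral_ge0.
have Ie : I - e%:E < I by rewrite lteBlDr// lteDl ?lte_fin.
have nI : nbhs I [set y | I - e%:E < y].
  by apply: open_nbhs_nbhs; split => //; exact: open_ereal_gt_ereal.
have [n _ /(_ n (leqnn _)) In] := cvg_integral_itv0 mf f0 nI.
have h0 : (0 < n.+1%:R^-1 :> R)%R by rewrite invr_gt0 ltr0n.
have h1 : (n.+1%:R^-1 <= 1 :> R)%R by rewrite invf_le1 ?ltr0n// ler1n.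
exists (n.+1%:R^-1)%R; first by rewrite h0.
move: In; rewrite /= {1}/I (integral_itv_split (ltW h0) h1 mf f0).
set J := \int[mu]_(x in `]_, 1%R]) f x; set K := \int[mu]_(x in `]0%R, _]) f x.
have Jf : J \is a fin_num.
  rewrite ge0_fin_numE.
    by apply: le_lt_trans foo; apply: integral_itvS => //; exact: ltW.
  apply: integral_ge0 => x xn; apply: f0; move: xn; rewrite /= !in_itv/= => /andP[nx ->].
  by rewrite andbT (lt_trans h0).
rewrite addeAC => /ltW; rewrite -[leRHS]add0e leeD2rE//.
by move=> Ke; rewrite -[leRHS]add0e -leeBlDr.
Qed.

End small_intervals.

(** * Gaps between cuts and their stability under [d_ p] *)

Section gaps.
Local Open Scope ereal_scope.
Context {R : realType} {m : nat}.
Local Notation mu := (@lebesgue_measure R).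
Implicit Types (u v w : 'rV[R]_m -> R) (a p h e : R).

Lemma cut_gap_ge0 h u a : compact_cuts u -> (0 <= h)%R -> (h < a <= 1)%R ->
  0 <= cut_gap h u a.
Proof.
move=> cu h0 /andP[ha a1]; apply: hausdorff_ge0.
by apply: (cu.2 a _).2; rewrite (le_lt_trans h0).
Qed.

Lemma cut_gapE h u a : compact_cuts u -> (0 <= h)%R -> (h < a <= 1)%R ->
  cut_gap h u a = excess (cut u (a - h)) (cut u a).
Proof.
move=> cu h0 /andP[ha a1]; rewrite /cut_gap hausdorffC hausdorff_nested//.
  by apply: (cu.2 a _).2; rewrite (le_lt_trans h0).
by apply: cut_subset; rewrite ?subr_gt0// lerBlDr lerDl.
Qed.

Lemma cut_gap_le h k u a : compact_cuts u -> (0 <= h)%R -> (h <= k)%R ->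
  (k < a <= 1)%R -> cut_gap h u a <= cut_gap k u a.
Proof.
move=> cu h0 hk /andP[ka a1]; rewrite !cut_gapE ?ka ?(le_trans h0)// ?(le_lt_trans hk)//.
by apply: excessS => //; apply: cut_subset; rewrite ?subr_gt0// lerB.
Qed.

(** The path goes from the cut of [v] at [a] to that of [u] at [a], then to [u] at [a - h] and back
    to [v] at [a - h]. The last leg becomes a piece of [Dp p u v] after a translation by [h]. *)
Lemma Gp_triangle p h u v : (0 <= p)%R -> compact_cuts u -> compact_cuts v ->
  (0 <= h <= 1)%R ->
  Gp p h v <= (3 `^ p)%:E * (Dp p u v + Gp p h u + Dp p u v).
Proof.
move=> p0 cu cv /andP[h0 h1].
have mD : measurable_fun `](0 : R)%R, 1%R] (cut_dist u v) by exact: measurable_cut_dist.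
have D0 x : `](0 : R)%R, 1%R]%classic x -> 0 <= cut_dist u v x.
  by rewrite in_itv01 => /cut_dist_ge0; exact.
have mpD := measurable_fun_poweR p mD.
have sub1 : `]h, 1%R]%classic `<=` `](0 : R)%R, 1%R]%classic.
  by move=> x /=; rewrite !in_itv/= => /andP[/(le_lt_trans h0)->].
have sub2 : `](h - h)%R, (1 - h)%R]%classic `<=` `](0 : R)%R, 1%R]%classic.
  rewrite subrr => x /=; rewrite !in_itv/= => /andP[-> /le_trans]; apply.
  by rewrite lerBlDr lerDl.
have mD2 : measurable_fun `](h - h)%R, (1 - h)%R] (cut_dist u v).
  exact: measurable_funS mD.
apply: (@le_trans _ _ ((3 `^ p)%:E * (\int[mu]_(a in `]h, 1%R]) cut_dist u v a `^ p +
    Gp p h u + \int[mu]_(a in `]h, 1%R]) cut_dist u v (a - h)%R `^ p))).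
  apply: integral_poweRD3_le => //.
  - exact: measurable_funS mD.
  - exact: measurable_cut_gap.
  - exact: measurable_fun_shift.
  - by move=> a; rewrite /= in_itv/= => ha1; exact: cut_gap_ge0.
  - by move=> a /sub1; exact: D0.
  - by move=> a; rewrite /= in_itv/= => ha1; exact: cut_gap_ge0.
  - move=> a; rewrite /= in_itv/= => /andP[ha a1]; apply: D0.
    by rewrite /= in_itv/= subr_gt0 ha lerBlDr (le_trans a1)// lerDl.
  move=> a; rewrite /= in_itv/= => /andP[ha a1].
  have a01 : (0 < a <= 1)%R by rewrite (le_lt_trans h0).
  have ah01 : (0 < a - h <= 1)%R by rewrite subr_gt0 ha lerBlDr (le_trans a1)// lerDl.
  rewrite /cut_gap /cut_dist (hausdorffC (cut u a)) -addeA.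
  have [cua cva cuh cvh] := And4 (cu.2 _ a01).2 (cv.2 _ a01).2 (cu.2 _ ah01).2 (cv.2 _ ah01).2.
  apply: le_trans (hausdorff_triangle cva cua cvh) _.
  by rewrite leeD2l// hausdorff_triangle.
apply: lee_wpmul2l; first by rewrite lee_fin powR_ge0.
apply: leeD.
  by apply: leeD => //; apply: ge0_subset_integral => // a _; exact: poweR_ge0.
rewrite (@ge0_integral_shift _ (fun x => cut_dist u v x `^ p)).
- by apply: ge0_subset_integral => // a _; exact: poweR_ge0.
- exact: measurable_fun_poweR.
- by move=> a _; exact: poweR_ge0.
Qed.

(** Left continuity gives a level [b < a] with small excess; for [h <= a - b] the cut at [a - h]
    lies inside the cut at [b]. *)
Lemma cvg_cut_gap u a (e : R) : compact_cuts u -> (0 < a <= 1)%R -> (0 < e)%R ->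
  exists2 d : R, (0 < d < a)%R & forall h, (0 <= h <= d)%R -> cut_gap h u a <= e%:E.
Proof.
move=> cu a01 e0; have [b /andP[b0 ba] be] := cut_left_continuous cu a01 e0.
exists (a - b)%R; first by rewrite subr_gt0 ba gtrBl.
move=> h /andP[h0 hab]; have /andP[a0 a1] := a01.
rewrite cut_gapE//; last by rewrite a1 (le_lt_trans hab)// gtrBl.
by apply: le_trans be; apply: excessS => //; apply: cut_subset => //; rewrite lerBrDl -lerBrDr.
Qed.

End gaps.

(** * Gaps of a single function as the step tends to [0] *)

Section gap_at_zero.
Local Open Scope ereal_scope.
Context {R : realType} {m : nat}.
Local Notation mu := (@lebesgue_measure R).
Implicit Types (u v w : 'rV[R]_m -> R) (a p h e : R).

Lemma cvge0_squeeze (f : (\bar R)^nat) :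
  (forall e : R, (0 < e)%R -> \forall n \near \oo, 0 <= f n <= e%:E) ->
  f @ \oo --> 0.
Proof.
move=> fe; apply/fine_cvgP; split.
  have := fe 1%R ltr01; apply: filterS => n /andP[f0 f1].
  by rewrite ge0_fin_numE// (le_lt_trans f1)// ltry.
apply/cvgr0Pnorm_le => e e0; have := fe e e0; apply: filterS => n /andP[f0 f1].
have ff : f n \is a fin_num by rewrite ge0_fin_numE// (le_lt_trans f1)// ltry.
by rewrite /= ger0_norm ?fine_ge0// -lee_fin fineK.
Qed.

Lemma integrable_cst_itv (r a b : R) : (a <= b)%R ->
  mu.-integrable `]a, b] (cst r%:E).
Proof.
move=> ab; apply/integrableP; split; first exact: measurable_cst.
by rewrite integral_cst_itv ?abse_ge0// ltry.
Qed.

(** Dominated convergence along the steps [k i]; monotonicity of the gap in its step then covers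
    every [h] below one of them. *)
Lemma Gp_away_small p u (n e : R) : (1 <= p)%R -> compact_cuts u ->
  (0 < n <= 1)%R -> (0 < e)%R ->
  exists2 d : R, (0 < d < n)%R & forall h, (0 <= h <= d)%R ->
    \int[mu]_(a in `]n, 1%R]) cut_gap h u a `^ p <= e%:E.
Proof.
move=> p1 cu /andP[n0 n1] e0; have p0 : (0 < p)%R by exact: lt_le_trans p1.
(* Starting at [n / 2] keeps [a - k i] above [n / 2] for [a > n], so that one compact cut contains
   all those that occur. *)
pose k (i : nat) : R := (n * i.+2%:R^-1)%R.
have k0 i : (0 < k i)%R by rewrite mulr_gt0// invr_gt0 ltr0n.
have kn2 i : (k i <= n / 2)%R.
  by rewrite ler_pM2l// lef_pV2 ?posrE ?ltr0n// ler_nat.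
have n20 : (0 < n / 2)%R by rewrite divr_gt0.
have n2n : (n / 2 < n)%R by rewrite ltr_pdivrMr// ltr_pMr// ltr1n.
have kn i : (k i < n)%R by rewrite (le_lt_trans (kn2 i)).
have n21 : (0 < n / 2 <= 1)%R by rewrite n20 (le_trans (ltW n2n)).
have i01 : (0 < (1 : R) <= 1)%R by rewrite ltr01 lexx.
have [/compact_edist_bounded[r ur] un0] := cu.2 _ n21.
have [/compact_edist_bounded[s us] u10] := cu.2 _ i01.
have r0 : (0 <= r + s)%R.
  have [x /ur xr] := un0; have [y /us ys] := u10.
  by rewrite addr_ge0// ?(le_trans _ xr)// ?(le_trans _ ys)// edist_ge0.
have nD a : `]n, 1%R]%classic a -> (n < a <= 1)%R by rewrite /= in_itv.
have ka i a : (n < a <= 1)%R -> (k i < a <= 1)%R.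
  by move=> /andP[na ->]; rewrite (lt_trans (kn i)).
have gap_ge0 i a : (n < a <= 1)%R -> 0 <= cut_gap (k i) u a.
  by move=> /ka na; apply: cut_gap_ge0 => //; exact: ltW.
(* The dominating constant bounds the excess of the cut at [n / 2] over the cut at [1]. *)
have gap_bound i a : (n < a <= 1)%R -> cut_gap (k i) u a <= (r + s)%:E.
  move=> na1; rewrite cut_gapE ?(ltW (k0 i)) ?ka//; case/andP : na1 => na a1.
  apply: le_trans (excess_finite un0 u10 ur us); apply: excessS.
    apply: cut_subset => //; rewrite lerBrDr (le_trans _ (ltW na))//.
    by rewrite [leRHS](splitr n) lerD2l.
  by apply: cut_subset => //; rewrite (lt_trans n0).
have mgap i : measurable_fun `]n, 1%R] (cut_gap (k i) u).
  apply: measurable_funS (measurable_cut_gap (ltW (k0 i)) cu) => //.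
  move=> a /=; rewrite !in_itv/= => /andP[na ->]; rewrite andbT.
  exact: lt_trans na.
have : \int[mu]_(a in `]n, 1%R]) cut_gap (k i) u a `^ p @[i --> \oo] -->
    \int[mu]_(a in `]n, 1%R]) cst 0 a.
  apply: (@dominated_cvg _ _ _ mu _ _ _ _ (cst ((r + s) `^ p)%:E)) => //.
  - by move=> i; apply: measurable_fun_poweR; exact: mgap.
  - move=> a /nD /andP[na a1]; apply: cvge0_squeeze => b b0.
    have a01 : (0 < a <= 1)%R by rewrite (lt_trans n0).
    have bp0 : (0 < b `^ p^-1)%R by rewrite powR_gt0.
    have [d /andP[d0 da] dh] := cvg_cut_gap cu a01 bp0.
    near=> i; rewrite poweR_ge0/=.
    have -> : b = (b `^ p^-1 `^ p)%R by rewrite -powRrM mulVf ?gt_eqF// powRr1// ltW.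
    rewrite -poweR_EFin; apply: le_poweR; first exact: ltW.
      by apply: gap_ge0; rewrite na.
    apply: dh; rewrite (ltW (k0 i))/=.
    have id : (d^-1 <= i%:R)%R by near: i; exact: nbhs_infty_ger.
    rewrite /k (@le_trans _ _ (i.+2%:R^-1)%R)//.
      by rewrite ler_piMl// invr_ge0 ler0n.
    rewrite -[leRHS]invrK lef_pV2 ?posrE ?invr_gt0 ?ltr0n//.
    by rewrite (le_trans id)// ler_nat -addn2 leq_addr.
  - exact: integrable_cst_itv.
  - move=> i a /nD na1; rewrite gee0_abs ?poweR_ge0// -poweR_EFin.
    by apply: le_poweR; [exact: ltW|exact: gap_ge0|exact: gap_bound].
rewrite integral0 => cvg0.
have nI : nbhs (0 : \bar R) [set y | y < e%:E].
  by apply: open_nbhs_nbhs; split; [exact: open_ereal_lt_ereal|rewrite /= lte_fin].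
have [i _ /(_ i (leqnn _)) /= ie] := cvg0 _ nI.
exists (k i); first by rewrite k0 kn.
move=> h /andP[h0 hk]; apply: le_trans (ltW ie).
apply: ge0_le_integral_nomeas => a /nD na1; first exact: poweR_ge0.
have ka1 := ka i a na1; have /andP[na a1] := na1.
apply: le_poweR; [exact: ltW| |exact: cut_gap_le].
by apply: cut_gap_ge0 => //; rewrite a1 (le_lt_trans hk)// (lt_trans (kn i)).
Unshelve. all: by end_near. Qed.

(** On []h, n]] the gap is bounded through the origin, by the distances of the cuts at [a] and
    [a - h] to it, both with small integral near [0]; on []n, 1]] the previous lemma applies. *)
Lemma Gp_small p u e : (1 <= p)%R -> compact_cuts u ->
  Dp p u zerohat < +oo -> (0 < e)%R ->
  exists2 d : R, (0 < d <= 1)%R & forall h, (0 <= h <= d)%R -> Gp p h u <= e%:E.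
Proof.
move=> p1 cu Duoo e0; have p0 : (0 < p)%R by exact: lt_le_trans p1.
pose c : R := (3 `^ p)%R; have c0 : (0 < c)%R by rewrite powR_gt0.
(* Two terms of this size multiplied by [c] give [e / 2], the share of []h, n]]. *)
have e10 : (0 < e / 4 / c)%R by rewrite !divr_gt0.
have cz := @compact_cuts_zerohat R m.
have mg : measurable_fun `](0 : R)%R, 1%R] (cut_dist u zerohat).
  exact: measurable_cut_dist.
have g0 x : (0 < x <= 1)%R -> 0 <= cut_dist u zerohat x.
  by move=> x01; exact: cut_dist_ge0.
have [n n01 ne] : exists2 n : R, (0 < n <= 1)%R &
    \int[mu]_(x in `]0%R, n]) cut_dist u zerohat x `^ p <= (e / 4 / c)%:E.
  apply: integral_itv0_small => //; first exact: measurable_fun_poweR.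
  by move=> x _; exact: poweR_ge0.
have e20 : (0 < e / 2)%R by rewrite divr_gt0.
have [d /andP[d0 dn] dh] := Gp_away_small p1 cu n01 e20.
have /andP[n0 n1] := n01.
exists d; first by rewrite d0 (le_trans (ltW dn)).
move=> h /andP[h0 hd]; have hn : (h < n)%R by exact: le_lt_trans dn.
rewrite /Gp (integral_itv_split (ltW hn) n1); last 2 first.
  by apply: measurable_fun_poweR; exact: measurable_cut_gap.
  by move=> x _; exact: poweR_ge0.
rewrite (splitr e) EFinD; apply: leeD; last by apply: dh; rewrite h0.
have sub1 : `]h, n]%classic `<=` `](0 : R)%R, 1%R]%classic.
  by move=> x /=; rewrite !in_itv/= => /andP[/(le_lt_trans h0)-> /le_trans->].
have sub2 : `](h - h)%R, (n - h)%R]%classic `<=` `](0 : R)%R, n]%classic.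
  rewrite subrr => x /=; rewrite !in_itv/= => /andP[-> /le_trans]; apply.
  by rewrite lerBlDr lerDl.
have sub3 : `](0 : R)%R, n]%classic `<=` `](0 : R)%R, 1%R]%classic.
  by move=> x /=; rewrite !in_itv/= => /andP[-> /le_trans->].
have mg2 : measurable_fun `](h - h)%R, (n - h)%R] (cut_dist u zerohat).
  by apply: measurable_funS mg => //; exact: subset_trans sub3.
apply: (@le_trans _ _ (c%:E * (\int[mu]_(a in `]h, n]) cut_dist u zerohat a `^ p +
    \int[mu]_(a in `]h, n]) cut_dist u zerohat (a - h)%R `^ p +
    \int[mu]_(a in `]h, n]) (cst 0 a) `^ p))).
  have hnD a : `]h, n]%classic a -> (h < a <= 1)%R.
    by rewrite /= in_itv/= => /andP[-> /le_trans->].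
  have ah01 a : (h < a <= 1)%R -> (0 < a - h <= 1)%R.
    by move=> /andP[ha a1]; rewrite subr_gt0 ha lerBlDr (le_trans a1)// lerDl.
  apply: integral_poweRD3_le => //.
  - exact: ltW.
  - exact: measurable_funS mg.
  - exact: measurable_fun_shift.
  - by move=> a /hnD ha; exact: cut_gap_ge0.
  - by move=> a /sub1; rewrite in_itv01; exact: g0.
  - by move=> a /hnD /ah01; exact: g0.
  move=> a /hnD ha; have a0 := ah01 _ ha; rewrite adde0.
  have a01 : (0 < a <= 1)%R by case/andP: ha => ha ->; rewrite (le_lt_trans h0).
  rewrite !cut_dist_zerohat// /cut_gap (hausdorffC (cut u (a - h))).
  apply: hausdorff_triangle; [exact: (cu.2 _ a01).2|by exists 0%R|exact: (cu.2 _ a0).2].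
have -> : \int[mu]_(a in `]h, n]) (cst 0 a) `^ p = 0.
  by apply: integral0_eq => a _; rewrite poweR0r ?gt_eqF.
have -> : (e / 2 = c * (e / 4 / c + e / 4 / c))%R by field; rewrite gt_eqF.
rewrite adde0 EFinM lee_pmul2l ?lte_fin// EFinD; apply: leeD; apply: le_trans ne.
  apply: integral_itvS => //.
    by apply: measurable_fun_poweR; exact: measurable_funS mg.
  by move=> x _; exact: poweR_ge0.
rewrite (@ge0_integral_shift _ (fun x => cut_dist u zerohat x `^ p)).
- apply: ge0_subset_integral => //.
    by apply: measurable_fun_poweR; exact: measurable_funS mg.
  by move=> x _; exact: poweR_ge0.
- exact: measurable_fun_poweR.
- by move=> x _; exact: poweR_ge0.
Qed.

End gap_at_zero.

#[local] Opaque d_.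

(** * The topology of [FBp] and the necessity of the mean conditions *)

Section FBp_metric.
Context {R : realType} {m : nat} {p : R}.
Hypothesis p1 : 1 <= p.
Implicit Types (u v w : FBp m p) (U : set (FBp m p)).

Lemma FBp_cuts u : compact_cuts u.
Proof. exact: FBp_compact_cuts p1 (FBpP u). Qed.

Let cuts := FBp_cuts.
Let p0 : 0 < p. Proof. exact: lt_le_trans p1. Qed.

(** The topology is declared by its open sets; that balls are open is the triangle inequality. *)
Lemma nbhs_dpP u (A : set (FBp m p)) : nbhs u A <->
  exists2 e : R, 0 < e & [set v : FBp m p | (d_ p u v < e%:E)%E] `<=` A.
Proof.
split=> [[B [oB Bu BA]]|[e e0 eA]].
  by have [e e0 eB] := oB _ Bu; exists e => //; exact: subset_trans BA.
exists [set v : FBp m p | (d_ p u v < e%:E)%E]; split => //; last first.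
  by rewrite /= (d_xx p0 (cuts u)) lte_fin.
move=> v /= uve.
have uvf : d_ p u v \is a fin_num.
  by rewrite ge0_fin_numE ?d_ge0// (lt_trans uve)// ltry.
exists (e - fine (d_ p u v)).
  by rewrite subr_gt0 -lte_fin fineK.
move=> w /= vwe.
apply: le_lt_trans (d_triangle p1 (cuts u) (cuts v) (cuts w)) _.
by rewrite addeC -lteBrDr// -[X in (_ - X)%E]fineK// -EFinB.
Qed.

Lemma FBp_inj u v : (u : 'rV[R]_m -> R) = v -> u = v.
Proof.
case: u v => [u uP] [v vP] /= uv; case: _ / uv vP => vP.
by congr MkFBp; exact: Prop_irrelevance.
Qed.

Lemma FBp_hausdorff : hausdorff_space (FBp m p).
Proof.
move=> u v clv; apply: FBp_inj.
have [fu _ _ _] := FBpP u; have [fv _ _ _] := FBpP v.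
apply: (d_eq0 p0 (cuts u) (cuts v) fu fv).
apply/le_anti; rewrite d_ge0 andbT; apply/lee_addgt0Pr => e e0.
have e20 : 0 < e / 2 by rewrite divr_gt0.
have nu : nbhs u [set w : FBp m p | (d_ p u w < (e / 2)%:E)%E].
  by apply/nbhs_dpP; exists (e / 2).
have nv : nbhs v [set w : FBp m p | (d_ p v w < (e / 2)%:E)%E].
  by apply/nbhs_dpP; exists (e / 2).
have [w [/= uw vw]] := clv _ _ nu nv.
apply: le_trans (d_triangle p1 (cuts u) (cuts w) (cuts v)) _.
by rewrite add0e (splitr e) EFinD (d_C p w v); exact: (leeD (ltW uw) (ltW vw)).
Qed.

(** In near-covering form, a bound that holds near each [u] for all large [n] holds on [U] for one
    [n]. On the unit ball round [u] the distance to [zerohat] exceeds that of [u] by at most [1]. *)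
Lemma compact_mean_bounded U : compact U -> uniformly_mean_bounded U.
Proof.
move=> /compact_near_coveringP cU.
have [n nU] : exists n : nat, U `<=` [set u : FBp m p | (d_ p u zerohat <= n%:R%:E)%E].
  apply: (@filter_ex _ \oo).
  apply: (cU nat \oo (fun n u => (d_ p u zerohat <= n%:R%:E)%E)) => u Uu.
  have uoo := FBp_zerohat_finite p1 (FBpP u).
  have uf : d_ p u zerohat \is a fin_num by rewrite ge0_fin_numE ?d_ge0.
  exists ([set v : FBp m p | (d_ p u v < 1%:E)%E],
          [set n : nat | 1 + fine (d_ p u zerohat) <= n%:R]).
    by split => /=; [apply/nbhs_dpP; exists 1|exact: nbhs_infty_ger].
  move=> [v n] /= [uv un].
  apply: le_trans (d_triangle p1 (cuts v) (cuts u) compact_cuts_zerohat) _.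
  apply: (@le_trans _ _ (1 + d_ p u zerohat)%E).
    by rewrite (d_C p v u); exact: leeD2r (ltW uv).
  by rewrite -(fineK uf) -EFinD lee_fin.
by exists n.+1%:R => // u /nU /= /le_trans; apply; rewrite lee_fin ler_nat.
Qed.

Lemma mean_gapE (h : R) u : 0 <= h -> (\int[lebesgue_measure]_(alpha in `[h, 1%R])
    hausdorff (cut u alpha) (cut u (alpha - h)%R) `^ p = Gp p h u)%E.
Proof.
move=> h0; rewrite -integral_itv_obnd_cbnd//.
by apply: measurable_fun_poweR; exact: measurable_cut_gap.
Qed.

(** The same scheme for steps below [1 / (n + 1)]: [Gp_triangle] carries small gaps of [u] over to a
    ball round [u]. *)
Lemma compact_mean_equi_left_continuous U :
  compact U -> mean_equi_left_continuous U.
Proof.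
move=> /compact_near_coveringP cU e e0.
pose c : R := 3 `^ p; have c0 : 0 < c by rewrite powR_gt0.
pose E := e `^ p; have E0 : 0 < E by rewrite powR_gt0.
(* Three terms of this size multiplied by [c] make [3 / 4] of [E], which keeps the final inequality
   strict. *)
have E10 : 0 < E / 4 / c by rewrite !divr_gt0.
have [n nU] : exists n : nat, U `<=` [set u : FBp m p | forall h,
    0 <= h < n.+1%:R^-1 -> (Gp p h u < E%:E)%E].
  apply: (@filter_ex _ \oo).
  apply: (cU nat \oo (fun n u => forall h, 0 <= h < n.+1%:R^-1 -> (Gp p h u < E%:E)%E)) => u Uu.
  have Duoo : (Dp p u zerohat < +oo)%E.
    have := FBp_zerohat_finite p1 (FBpP u).
    rewrite (d_E p (cuts u) compact_cuts_zerohat).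
    by apply: lty_poweRy; rewrite invr_neq0// gt_eqF.
  have [d /andP[d0 d1] dh] := Gp_small p1 (cuts u) Duoo E10.
  exists ([set v : FBp m p | (d_ p u v < ((E / 4 / c) `^ p^-1)%:E)%E],
          [set n : nat | d^-1 <= n%:R]).
    split => /=; last exact: nbhs_infty_ger.
    by apply/nbhs_dpP; exists ((E / 4 / c) `^ p^-1) => //; rewrite powR_gt0.
  move=> [v n] /= [uv un] h /andP[h0 hn].
  have {}hn : h <= d.
    rewrite (le_trans (ltW hn))// -[leRHS]invrK lef_pV2 ?posrE ?invr_gt0 ?ltr0n//.
    by rewrite (le_trans un)// ler_nat.
  have h1 : h <= 1 by exact: le_trans d1.
  have {}uv : (Dp p u v <= (E / 4 / c)%:E)%E.
    move: uv; rewrite (d_E p (cuts u) (cuts v)) poweRV_lt ?powR_gt0 ?Dp_ge0//.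
    by rewrite -powRrM mulVf ?gt_eqF// powRr1 ?(ltW E10)//; exact: ltW.
  have h01 : 0 <= h <= 1 by rewrite h0.
  apply: le_lt_trans (Gp_triangle (ltW p0) (cuts u) (cuts v) h01) _.
  apply: (@le_lt_trans _ _ (c * (E / 4 / c + E / 4 / c + E / 4 / c))%:E).
    have hd : (Gp p h u <= (E / 4 / c)%:E)%E by apply: dh; rewrite h0.
    rewrite EFinM !EFinD; apply: lee_wpmul2l; first by rewrite lee_fin ltW.
    exact: (leeD (leeD uv hd) uv).
  have -> : c * (E / 4 / c + E / 4 / c + E / 4 / c) = E * (3 / 4).
    by field; rewrite gt_eqF.
  by rewrite lte_fin gtr_pMr//; lra.
exists n.+1%:R^-1; first by rewrite invr_gt0 ltr0n.
move=> h u hn Uu; have /andP[h0 _] := hn.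
by rewrite (mean_gapE u h0) poweRV_lt ?Gp_ge0//; exact: nU hn.
Qed.

End FBp_metric.

(** * Hausdorff limits of sets along an ultrafilter *)

Section limit_sets.
Context {R : realType} {m : nat} {T : Type} (F : set_system T).
Context {UF : UltraFilter F}.
Implicit Types (A B : T -> set 'rV[R]_m).

(** The lower Kuratowski limit along [F]; for an ultrafilter it agrees with the upper one. *)
Definition limit_set A : set 'rV[R]_m :=
  [set x | forall e : R, 0 < e -> F [set t | exists2 y, A t y & edist x y < e]].

Lemma limit_set_closed A : closed (limit_set A).
Proof.
move=> x clx e e0; have e20 : 0 < e / 2 by rewrite divr_gt0.
have [y [yA xy]] := clx _ (near_edist x e20).
apply: filterS (yA _ e20) => t [z Az yz]; exists z => //.
by rewrite (le_lt_trans (edist_triangle y _ _))// (splitr e) ltrD.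
Qed.

Lemma limit_setS A B : F [set t | A t `<=` B t] -> limit_set A `<=` limit_set B.
Proof.
move=> AB x Ax e e0; apply: filterS2 AB (Ax _ e0) => t ABt [y /ABt By xy].
by exists y.
Qed.

Lemma limit_set_bounded A (r : R) :
  F [set t | A t `<=` [set x | edist x 0 <= r]] ->
  limit_set A `<=` [set x | edist x 0 <= r].
Proof.
move=> Ar x Ax /=; apply/ler_addgt0Pr => e e0.
have [t [/= Atr [y /Atr /= yr xy]]] := filter_ex (filterI Ar (Ax _ e0)).
by rewrite (le_trans (edist_triangle y _ _))// addrC lerD// ltW.
Qed.

(** Each point of the ball either lies in the limit set or has a neighbourhood that [A t] avoids for
    [F]-most [t]; compactness of the ball makes this uniform. *)
Lemma excess_to_limit_set A (r e : R) :
  F [set t | A t `<=` [set x | edist x 0 <= r]] -> 0 < e ->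
  F [set t | (excess (A t) (limit_set A) <= e%:E)%E].
Proof.
move=> Ar e0; have /compact_near_coveringP cov := @compact_edist_ball R m r.
have cvr : \forall t \near F, [set x | edist x 0 <= r] `<=`
    (fun x => A t x -> exists2 y, limit_set A y & edist x y <= e); last first.
  apply: filterS (filterI Ar cvr) => t [tr tP].
  by apply: excess_le => x Ax; apply: tP => //; exact: tr.
apply: (cov T F (fun t x => A t x -> exists2 y, limit_set A y & edist x y <= e)) => x _.
have [Ax|/existsNP[d /not_implyP[d0 nF]]] := pselect (limit_set A x).
  exists ([set y | edist x y < e], setT); first by split; [exact: near_edist|exact: filterT].
  by move=> [y t] /= [xy _] _; exists x => //; rewrite edistC ltW.
(* The ultrafilter property turns the failure of a property to hold along [F] into its negation
   along [F]. *)
have [//|Fd] := in_ultra_setVsetC [set t | exists2 y, A t y & edist x y < d] UF.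
exists ([set y | edist x y < d], ~` [set t | exists2 y, A t y & edist x y < d]).
  by split => //; exact: near_edist.
by move=> [y t] /= [xy nA] Ay; case: nA; exists y.
Qed.

(** A point of the limit set has points of [A t] within [e / 2] by definition, and the other [e / 2]
    serves its neighbours. Around any other point the claim is vacuous, since the limit set is
    closed. *)
Lemma excess_from_limit_set A (r e : R) :
  F [set t | A t `<=` [set x | edist x 0 <= r]] -> 0 < e ->
  F [set t | (excess (limit_set A) (A t) <= e%:E)%E].
Proof.
move=> Ar e0; have /compact_near_coveringP cov := @compact_edist_ball R m r.
have cvr : \forall t \near F, [set x | edist x 0 <= r] `<=`
    (fun x => limit_set A x -> exists2 y, A t y & edist x y <= e); last first.
  apply: filterS cvr => t tP.
  apply: excess_le => x Ax; apply: tP => //.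
  exact: (limit_set_bounded Ar).
apply: (cov T F (fun t x => limit_set A x -> exists2 y, A t y & edist x y <= e)) => x _.
have e20 : 0 < e / 2 by rewrite divr_gt0.
have [Ax|nAx] := pselect (limit_set A x).
  exists ([set y | edist x y < e / 2], [set t | exists2 y, A t y & edist x y < e / 2]).
    by split; [exact: near_edist|exact: Ax].
  move=> [y t] /= [xy [z Az xz]] _; exists z => //.
  rewrite (le_trans (edist_triangle x _ _))// (splitr e) lerD// ltW//.
  by rewrite edistC.
exists (~` limit_set A, setT); last by move=> [y t] [].
split; last exact: filterT.
by apply: open_nbhs_nbhs; split => //; apply: closed_openC; exact: limit_set_closed.
Qed.

(** A nonempty [A t] with finite excess over the limit set has a point close to it. *)
Lemma limit_set_neq0 A (r : R) :
  F [set t | A t `<=` [set x | edist x 0 <= r]] -> F [set t | A t !=set0] ->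
  limit_set A !=set0.
Proof.
move=> Ar A0; have Ae := excess_to_limit_set Ar ltr01.
have [t [[x Ax] /= At1]] := filter_ex (filterI A0 Ae).
have [y Ay _] : exists2 y, limit_set A y & ((edist x y)%:E < 2%:E)%E.
  by apply: excess_lt Ax; apply: le_lt_trans At1 _; rewrite lte_fin ltr1n.
by exists y.
Qed.

End limit_sets.

(** * The fuzzy set defined by a decreasing family of closed sets *)

Section level_function.
Context {R : realType} {m : nat} (K : R -> set 'rV[R]_m).
Hypothesis subK : forall s t, 0 < s -> s <= t -> t <= 1 -> K t `<=` K s.
Hypothesis closedK : forall t, 0 < t <= 1 -> closed (K t).
Hypothesis boundedK : forall t, 0 < t <= 1 ->
  exists r : R, K t `<=` [set x | edist x 0 <= r].
Hypothesis K1_neq0 : K 1 !=set0.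

(** The level [0] is adjoined so that the set is inhabited and the supremum is [0] outside all the
    [K a]. *)
Let levels x : set R := [set a | a = 0 \/ (0 < a <= 1 /\ K a x)].

Definition level_function (x : 'rV[R]_m) : R := sup (levels x).

Let levels_ub x : ubound (levels x) 1.
Proof. by move=> a [->|[/andP[]]]. Qed.

Let levels_sup x : has_sup (levels x).
Proof. by split; [exists 0; left|exists 1; exact: levels_ub]. Qed.

Lemma level_function_fuzzy : fuzzy level_function.
Proof.
move=> x; apply/andP; split.
  by apply: ub_le_sup; [exact: (levels_sup x).2|left].
by apply: ge_sup; [exact: (levels_sup x).1|exact: levels_ub].
Qed.

(** Intersecting over [b < a] restores the left continuity that cuts have and a family of limit sets
    may lack. A value below [a] is refuted by a level halfway up to [a]. *)
Lemma level_functionP a x : 0 < a <= 1 ->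
  cut level_function a x <-> (forall b, 0 < b < a -> K b x).
Proof.
move=> /andP[a0 a1]; rewrite cut_gt0//=; split=> [ax b /andP[b0 ba]|Kx].
  have [c [->|[/andP[c0 c1] Kc]]] := sup_gt (levels_sup x).1 (lt_le_trans ba ax).
    by rewrite ltNge ltW.
  by move=> bc; apply: subK Kc => //; exact: ltW.
rewrite leNgt; apply/negP => xa.
have /andP[x0 _] := level_function_fuzzy x.
pose b := (level_function x + a) / 2.
have xb : level_function x < b by rewrite midf_lt.
have ba : b < a by rewrite midf_lt.
have b0 : 0 < b by exact: le_lt_trans xb.
move: xb; rewrite ltNge => /negP; apply; apply: ub_le_sup; first exact: (levels_sup x).2.
by right; split; [rewrite b0 (le_trans (ltW ba))|apply: Kx; rewrite b0].
Qed.

Lemma sub_cut_level a : 0 < a <= 1 -> K a `<=` cut level_function a.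
Proof.
move=> a01 x Kx; apply/level_functionP => // b /andP[b0 ba].
by case/andP: a01 => a0 a1; apply: subK Kx => //; exact: ltW.
Qed.

Lemma cut_level_sub a b : 0 < b < a -> a <= 1 -> cut level_function a `<=` K b.
Proof.
move=> /andP[b0 ba] a1 x /level_functionP; apply; last by rewrite b0.
by rewrite a1 (lt_trans b0).
Qed.

Lemma level_function_normal : fuzzy_normal level_function.
Proof.
have [x K1] := K1_neq0; exists x; apply/le_anti.
have /andP[_ ->] /= := level_function_fuzzy x.
have : cut level_function 1 x by apply: sub_cut_level; rewrite // ltr01 lexx.
by rewrite cut_gt0.
Qed.

Lemma level_function_usc : fuzzy_usc level_function.
Proof.
(* Upper semicontinuity is stated through the opposite function, so the level in play is [- a]. *)
move=> x a; rewrite lte_fin ltrNr => xa; have /andP[x0 x1] := level_function_fuzzy x.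
have a0 : 0 < - a by exact: le_lt_trans xa.
have [a1|a1] := leP (- a) 1; last first.
  exists setT; first exact: filterT.
  move=> y _; rewrite lte_fin ltrNr (le_lt_trans _ a1)//.
  by have /andP[] := level_function_fuzzy y.
have : ~ cut level_function (- a) x by rewrite cut_gt0//=; apply/negP; rewrite -ltNge.
rewrite level_functionP ?a0// => /existsNP[b /not_implyP[/andP[b0 ba] nKb]].
have b1 : b <= 1 by rewrite (le_trans (ltW ba)).
(* At a point outside [K b] the value is less than [- a], because the cut at [- a] lies in [K b]. *)
exists (~` K b).
  by apply: open_nbhs_nbhs; split => //; apply: closed_openC; apply: closedK; rewrite b0.
move=> y nKy; rewrite lte_fin ltrNr ltNge; apply/negP => ay; apply: nKy.
by apply: (@cut_level_sub (- a)); rewrite ?b0// cut_gt0.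
Qed.

Lemma level_function_compact_cuts : compact_cuts level_function.
Proof.
split; first exact: level_function_usc.
move=> a /andP[a0 a1]; split; last exact: cut_neq0 level_function_normal a1.
have a20 : 0 < a / 2 by rewrite divr_gt0.
have a2a : a / 2 < a by rewrite ltr_pdivrMr// ltr_pMr// ltr1n.
have [|r Kr] := @boundedK (a / 2); first by rewrite a20 (le_trans (ltW a2a)).
apply: (subclosed_compact _ (@compact_edist_ball R m r)).
  by apply: cut_closed => //; exact: level_function_usc.
by apply: subset_trans Kr; apply: cut_level_sub => //; rewrite a20.
Qed.

(* Closeness of [cut u] and [K] is needed only at two points [s < a <= t] of a
   finite grid; the gaps of [u] carry it over to the level [a]. *)
Lemma cut_dist_level (u : 'rV[R]_m -> R) (a h s t e : R) : compact_cuts u ->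
  0 < h -> h < a <= 1 - h -> a - h <= s < a -> a <= t <= a + h ->
  (excess (K s) (cut u s) <= e%:E)%E -> (excess (cut u t) (K t) <= e%:E)%E ->
  (cut_dist u level_function a <= e%:E + cut_gap h u a + cut_gap h u (a + h))%E.
Proof.
move=> cu h0 /andP[ha ah1] /andP[hs sa] /andP[at_ th] Ks Kt.
have h0' := ltW h0.
have a0 : 0 < a by exact: lt_trans ha.
have a1 : a <= 1 by rewrite (le_trans ah1)// gerBl.
have ah1' : a + h <= 1 by rewrite -lerBrDr.
have s0 : 0 < s by rewrite (lt_le_trans _ hs)// subr_gt0.
have t0 : 0 < t by exact: lt_le_trans at_.
have t1 : t <= 1 by exact: le_trans ah1'.
have s1 : s <= 1 by rewrite (le_trans (ltW sa)).
have g1 : (0 <= cut_gap h u a)%E by apply: cut_gap_ge0; rewrite // ha.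
have hah : h < a + h by rewrite ltrDr.
have g2 : (0 <= cut_gap h u (a + h))%E by apply: cut_gap_ge0; rewrite // hah.
have [us0 ut0] : cut u s !=set0 /\ cut u t !=set0.
  by split; [apply: (cu.2 _ _).2; rewrite s0|apply: (cu.2 _ _).2; rewrite t0].
rewrite /cut_dist hausdorffE ge_max; apply/andP; split.
  apply: (@le_trans _ _ (excess (cut u a) (K t))).
    apply: excessS => // x Kx; apply: (@cut_subset _ _ _ a t) => //.
    by apply: sub_cut_level; rewrite ?t0.
  apply: le_trans (excess_triangle _ _ ut0) _; rewrite addeC -addeA addeCA.
  rewrite (@le_trans _ _ (e%:E + cut_gap h u (a + h))%E)//; last by rewrite leeDr.
  apply: leeD => //; rewrite cut_gapE ?hah// addrK; apply: excessS => //.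
  by apply: cut_subset.
apply: (@le_trans _ _ (excess (K s) (cut u a))).
  by apply: excessS => //; apply: cut_level_sub => //; rewrite s0.
apply: le_trans (excess_triangle _ _ us0) _.
rewrite (@le_trans _ _ (e%:E + cut_gap h u a)%E)//; last by rewrite leeDl.
apply: leeD => //; rewrite cut_gapE ?ha//; apply: excessS => //.
by apply: cut_subset => //; rewrite subr_gt0.
Qed.

End level_function.

(** With [k] the integer part of [a / (h / 2)], the neighbours [k - 1] and [k + 1] serve; [k] itself
    may fall exactly on [a], while a point strictly below [a] is wanted. *)
Lemma grid_points {R : realType} (h a : R) : 0 < h -> h < a <= 1 - h ->
  exists i j : nat, [/\ a - h <= i%:R * (h / 2) < a, a <= j%:R * (h / 2) <= a + h,
    0 < i%:R * (h / 2) & j%:R * (h / 2) <= 1].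
Proof.
move=> h0 /andP[ha ah1]; pose k := Num.truncn (a / (h / 2)).
have h20 : 0 < h / 2 by rewrite divr_gt0.
have a0 : 0 < a by exact: lt_trans ha.
have /andP[] : k%:R <= a / (h / 2) < k.+1%:R by apply: truncn_itv; rewrite divr_ge0 ?ltW.
rewrite ler_pdivlMr// ltr_pdivrMr// => ka ak.
have k1 : (1 <= k)%N.
  rewrite lt0n; apply/eqP => k0; move: ak; rewrite k0 mul1r => ah2; lra.
have kS : k.+1%:R = k%:R + 1 :> R by rewrite -addn1 natrD.
have kP : k.-1%:R = k%:R - 1 :> R by rewrite -subn1 natrB.
exists k.-1, k.+1; rewrite kP kS in ak *.
split; [apply/andP; split; lra|apply/andP; split; lra|lra|lra].
Qed.

(** * Convergence of ultrafilters under the two mean conditions *)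

Section ultrafilter_limit.
Local Open Scope ereal_scope.
Context {R : realType} {m : nat} {p : R}.
Hypothesis p1 : (1 <= p)%R.
Variables (U : set (FBp m p)) (F : set_system (FBp m p)).
Hypothesis bU : uniformly_mean_bounded U.
Hypothesis eU : mean_equi_left_continuous U.
Context {UF : UltraFilter F}.
Hypothesis FU : F U.
Local Notation mu := (@lebesgue_measure R).
Implicit Types (u v : FBp m p) (a e h : R).

Let p0 : (0 < p)%R. Proof. exact: lt_le_trans p1. Qed.
Let cuts (u : FBp m p) : compact_cuts u. Proof. exact: FBp_cuts. Qed.
Let cz := @compact_cuts_zerohat R m.
Let c : R := (3 `^ p)%R.
Let c0 : (0 < c)%R. Proof. by rewrite powR_gt0. Qed.

Let powerE e : (0 < e)%R -> exists2 d : R, (0 < d)%R & (d `^ p)%R = e.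
Proof.
move=> e0; exists (e `^ p^-1)%R; first by rewrite powR_gt0.
by rewrite -powRrM mulVf ?gt_eqF// powRr1// ltW.
Qed.

Lemma Dp_uniform_bound : exists2 M : R, (0 < M)%R &
  forall u, U u -> Dp p u zerohat <= M%:E.
Proof.
have [M M0 MU] := bU; exists (M `^ p)%R; first by rewrite powR_gt0.
by move=> u /MU; rewrite (d_E p (cuts u) cz) poweRV_le ?Dp_ge0// ltW.
Qed.

Lemma cut_uniform_bound a : (0 < a <= 1)%R ->
  exists2 r : R, (0 <= r)%R & forall u, U u -> cut u a `<=` [set x | (edist x 0 <= r)%R].
Proof.
move=> /andP[a0 a1]; have [M M0 MU] := Dp_uniform_bound.
(* This radius solves [r ^ p * a = M]. *)
exists ((M / a) `^ p^-1)%R; first exact: powR_ge0.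
move=> u Uu x; apply: excess0_le.
have [_ nu _ _] := FBpP u; have := @excess0_poweR_le _ _ p u a (ltW p0) nu.
rewrite a0 a1 => /(_ isT); rewrite (Dp_zerohatE p (cuts u)) => /le_trans/(_ (MU _ Uu)).
rewrite -lee_pdivlMr// => H.
have u0 : 0 <= excess (cut u a) [set 0%R] by apply: excess_ge0; exact: cut_neq0.
have -> : excess (cut u a) [set 0%R] = (excess (cut u a) [set 0%R] `^ p) `^ p^-1.
  by rewrite -poweRrM mulfV ?gt_eqF// poweRe1.
rewrite -poweR_EFin EFinM; apply: le_poweR; rewrite ?poweR_ge0 ?invr_ge0 ?(ltW p0)//.
Qed.

Lemma Gp_uniform_small e : (0 < e)%R -> exists2 d : R, (0 < d)%R &
  forall h u, (0 <= h < d)%R -> U u -> Gp p h u <= e%:E.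
Proof.
move=> e0; have [s s0 se] := powerE e0.
have [d d0 dU] := eU s0; exists d => // h u hd Uu.
have /andP[h0 _] := hd; have := dU h u hd Uu.
by rewrite (mean_gapE p1 u h0) poweRV_lt ?Gp_ge0// se; exact: ltW.
Qed.

Lemma measurable_zerohat_dist u : measurable_fun `](0 : R)%R, 1%R] (cut_dist u zerohat).
Proof. exact: measurable_cut_dist. Qed.

(** For a fixed [s], the cut at [x] is compared with the cut at [x + s]: the difference is a gap of
    step [s], small in p-mean, and the cut at [x + s] lies in a ball independent of [u], whose
    contribution is proportional to [h]. *)
Lemma initial_uniform_small e : (0 < e)%R -> exists2 d : R, (0 < d)%R &
  forall h u, (0 <= h <= d)%R -> U u ->
    \int[mu]_(a in `]0%R, h]) cut_dist u zerohat a `^ p <= e%:E.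
Proof.
move=> e0; have e10 : (0 < e / 2 / c)%R by rewrite !divr_gt0.
have [d d0 dU] := Gp_uniform_small e10.
pose s := (Num.min (d / 2) (1 / 2))%R.
have s0 : (0 < s)%R by rewrite lt_min !divr_gt0.
have sd : (s < d)%R by rewrite gt_min ltr_pdivrMr// ltr_pMr// ltr1n.
have s2 : (s <= 1 / 2)%R by rewrite ge_min lexx orbT.
have s01 : (0 < s <= 1)%R by rewrite s0; lra.
have [r r0 rU] := cut_uniform_bound s01.
pose q := (r `^ p)%R; have q0 : (0 <= q)%R by exact: powR_ge0.
have q10 : (0 < q + 1)%R by rewrite ltr_wpDl.
(* Together with [s <= 1 / 2] the first bound keeps [x + s] within [1]; the second makes [q * h]
   small, with [q + 1] in place of [q] in case [q] is [0]. *)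
exists (Num.min (1 / 2) (e / 2 / c / (q + 1)))%R.
  by rewrite lt_min !divr_gt0.
move=> h u; rewrite le_min => /andP[h0 /andP[h2 hq]] Uu.
have hD x : `]0%R, h]%classic x -> (0 < x <= h)%R by rewrite /= in_itv.
have xs x : (0 < x <= h)%R -> (s < x + s <= 1)%R by move=> /andP[? ?]; apply/andP; split; lra.
have x1 x : (0 < x <= h)%R -> (0 < x <= 1)%R by move=> /andP[? ?]; apply/andP; split; lra.
have xs1 x : (0 < x <= h)%R -> (0 < x + s <= 1)%R by move=> /andP[? ?]; apply/andP; split; lra.
have mg : measurable_fun `](0 + s)%R, (h + s)%R] (cut_gap s u).
  apply: measurable_funS (measurable_cut_gap (ltW s0) (cuts u)) => //.
  by move=> x /=; rewrite !in_itv/= add0r => /andP[-> /le_trans]; apply; lra.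
apply: (@le_trans _ _ (c%:E * (\int[mu]_(a in `]0%R, h]) cut_gap s u (a + s)%R `^ p +
    \int[mu]_(a in `]0%R, h]) (cst r%:E a) `^ p +
    \int[mu]_(a in `]0%R, h]) (cst 0 a) `^ p))).
  apply: integral_poweRD3_le => //.
  - exact: ltW.
  - exact: measurable_fun_shift.
  - by move=> x /hD /x1 x01; exact: cut_dist_ge0.
  - by move=> x /hD /xs x01; exact: cut_gap_ge0 (ltW s0) x01.
  move=> x /hD hx; rewrite adde0.
  have xx := x1 _ hx; have xxs := xs1 _ hx.
  rewrite /cut_gap addrK cut_dist_zerohat// (hausdorffC (cut u (x + s))).
  have z0 : [set (0 : 'rV[R]_m)%R] !=set0 by exists 0%R.
  apply: (le_trans (hausdorff_triangle ((cuts u).2 _ xx).2 ((cuts u).2 _ xxs).2 z0)).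
  apply: leeD2l; rewrite hausdorffE ge_max.
  have ur y : cut u (x + s) y -> (edist y 0 <= r)%R.
    move=> uy; apply: (rU _ Uu); apply: cut_subset uy => //.
    by case/andP : hx => hx _; lra.
  apply/andP; split; apply: excess_le.
    by move=> y /ur yr; exists 0%R.
  move=> _ ->; have [y uy] := ((cuts u).2 _ xxs).2; exists y => //.
  by rewrite edistC; exact: ur.
rewrite (@ge0_integral_shift _ (fun x => cut_gap s u x `^ p)); last 2 first.
  exact: measurable_fun_poweR.
  by move=> x _; exact: poweR_ge0.
have -> : \int[mu]_(a in `]0%R, h]) (cst 0 a) `^ p = 0.
  by apply: integral0_eq => a _; rewrite poweR0r ?gt_eqF.
rewrite adde0 (integral_cst_poweR r p h0) subr0.
have -> : e%:E = c%:E * ((e / 2 / c)%:E + (e / 2 / c)%:E).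
  by rewrite -EFinD -EFinM; congr EFin; field; rewrite gt_eqF.
apply: lee_wpmul2l; first by rewrite lee_fin ltW.
apply: leeD.
  apply: le_trans (dU s u _ Uu); last by rewrite sd ltW.
  apply: ge0_subset_integral => //.
  - by apply: measurable_fun_poweR; apply: measurable_cut_gap => //; exact: ltW.
  - by move=> x _; exact: poweR_ge0.
  - by move=> x /=; rewrite !in_itv/= add0r => /andP[-> /le_trans]; apply; lra.
rewrite lee_fin; apply: (@le_trans _ _ ((q + 1) * h)%R).
  by apply: ler_wpM2r => //; rewrite lerDl.
by rewrite mulrC -ler_pdivlMr.
Qed.

Let K a : set 'rV[R]_m := limit_set F (fun u : FBp m p => cut u a).

Let near_bounded a (r : R) :
  (forall u, U u -> cut u a `<=` [set x | (edist x 0 <= r)%R]) ->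
  F [set u : FBp m p | cut u a `<=` [set x | (edist x 0 <= r)%R]].
Proof. by move=> rU; apply: filterS FU => u /rU. Qed.

Let subK s t : (0 < s)%R -> (s <= t)%R -> (t <= 1)%R -> K t `<=` K s.
Proof. by move=> s0 st _; apply: limit_setS; apply: filterS FU => u _; exact: cut_subset. Qed.

Let closedK t : (0 < t <= 1)%R -> closed (K t).
Proof. by move=> _; exact: limit_set_closed. Qed.

Let boundedK t : (0 < t <= 1)%R ->
  exists r : R, K t `<=` [set x | (edist x 0 <= r)%R].
Proof.
move=> /cut_uniform_bound[r _ rU]; exists r.
by apply: limit_set_bounded; exact: near_bounded.
Qed.

Let K1_neq0 : K 1 !=set0.
Proof.
have i01 : (0 < (1 : R) <= 1)%R by rewrite ltr01 lexx.
have [r _ rU] := cut_uniform_bound i01.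
apply: (limit_set_neq0 (near_bounded rU)).
by apply: filterS FU => u _; exact: ((cuts u).2 _ i01).2.
Qed.

Let v := level_function K.

Let cv : compact_cuts v.
Proof. exact: level_function_compact_cuts. Qed.

Let near_excess e a : (0 < e)%R -> (0 < a <= 1)%R ->
  F [set u : FBp m p | excess (K a) (cut u a) <= e%:E /\ excess (cut u a) (K a) <= e%:E].
Proof.
move=> e0 /cut_uniform_bound[r _ /near_bounded rF].
apply: filterS (filterI (excess_from_limit_set rF e0) (excess_to_limit_set rF e0)).
by move=> u [].
Qed.

(** Only finitely many multiples of [h] lie in []0, 1]], and a filter is closed under finite
    intersections. *)
Let near_excess_grid e h : (0 < e)%R -> (0 < h)%R ->
  F [set u : FBp m p | forall i : nat, (0 < i%:R * h <= 1)%R ->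
    excess (K (i%:R * h)) (cut u (i%:R * h)) <= e%:E /\
    excess (cut u (i%:R * h)) (K (i%:R * h)) <= e%:E].
Proof.
move=> e0 h0; pose N := (Num.truncn h^-1).+1.
have : F [set u : FBp m p | forall i : 'I_N, (0 < i%:R * h <= 1)%R ->
    excess (K (i%:R * h)) (cut u (i%:R * h)) <= e%:E /\
    excess (cut u (i%:R * h)) (K (i%:R * h)) <= e%:E].
  apply: filter_forall => i.
  have [ih|nih] := pselect (0 < i%:R * h <= 1)%R; last by apply: filterS FU => u _ /nih.
  by apply: filterS (near_excess e0 ih) => u + _.
apply: filterS => u uN i ih.
have iN : (i < N)%N.
  have /andP[_ ih1] := ih.
  have : (i%:R <= h^-1)%R by rewrite -[leRHS]mul1r ler_pdivlMr.
  by move=> /le_lt_trans/(_ (truncnS_gt _)); rewrite ltr_nat.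
exact: (uN (Ordinal iN)).
Qed.

(** On []h, 1 - h]] the grid estimate [cut_dist_level] applies. On []1 - h, 1]], where [a + h]
    exceeds [1], the distances are bounded and the interval is short. The set of [u] in [F] depends
    on [h]. *)
Lemma near_integral_cut_dist e : (0 < e)%R -> exists2 d : R, (0 < d < 1)%R &
  forall h, (0 < h <= d)%R ->
  F [set u : FBp m p | \int[mu]_(a in `]h, 1%R]) cut_dist u v a `^ p <= e%:E].
Proof.
(* Three terms multiplied by [c] and one boundary term, each at most [e1], add up to [e]. *)
move=> e0; pose e1 := (e / (3 * c + 1))%R.
have c10 : (0 < 3 * c + 1)%R by rewrite addr_gt0// mulr_gt0.
have e10 : (0 < e1)%R by rewrite divr_gt0.
have [d d0 dU] := Gp_uniform_small e10.
have [b b0 be] := powerE e10.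
have i01 : (0 < (1 / 2 : R) <= 1)%R by apply/andP; split; lra.
have [r r0 rU] := cut_uniform_bound i01.
have [/compact_edist_bounded[s vs] v0] := cv.2 _ i01.
have s0 : (0 <= s)%R by have [x /vs] := v0; apply: le_trans; exact: edist_ge0.
pose q := ((r + s) `^ p)%R; have q0 : (0 <= q)%R by exact: powR_ge0.
have q10 : (0 < q + 1)%R by rewrite ltr_wpDl.
(* The bound [1 / 3] keeps [1 - h] above both [h] and [1 / 2], the level at which [r] and [s] were
   taken; [d / 2] gives [h < d]; the last bound handles the boundary term. *)
exists (Num.min (1 / 3) (Num.min (d / 2) (e1 / (q + 1))))%R.
  rewrite !lt_min gt_min; apply/andP; split; last by apply/orP; left; lra.
  by rewrite !divr_gt0.
move=> h; rewrite !le_min => /andP[h0 /andP[h3 /andP[hd hq]]].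
have h20 : (0 < h / 2)%R by rewrite divr_gt0.
apply: filterS (filterI FU (near_excess_grid b0 h20)) => u [Uu uK] /=.
have hh : (h <= 1 - h)%R by lra.
have h1 : (1 - h <= 1)%R by lra.
have mD : measurable_fun `](0 : R)%R, 1%R] (cut_dist u v) by exact: measurable_cut_dist.
have subh : `]h, 1%R]%classic `<=` `](0 : R)%R, 1%R]%classic.
  by move=> x /=; rewrite !in_itv/= => /andP[/(lt_trans h0)->].
have sub1h : `]h, (1 - h)%R]%classic `<=` `]h, 1%R]%classic.
  by move=> x /=; rewrite !in_itv/= => /andP[-> /le_trans->].
rewrite (integral_itv_split hh h1); last 2 first.
  by apply: measurable_fun_poweR; exact: measurable_funS mD.
  by move=> x _; exact: poweR_ge0.
have ee1 : e = (c * (e1 + e1 + e1) + e1)%R by rewrite /e1; field; rewrite gt_eqF.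
rewrite ee1 EFinD EFinM !EFinD.
have Gh : Gp p h u <= e1%:E by apply: dU => //; apply/andP; split; lra.
apply: leeD; last first.
  apply: (@le_trans _ _ (\int[mu]_(a in `](1 - h)%R, 1%R]) q%:E)).
    apply: ge0_le_integral_nomeas => a; first by move=> _; exact: poweR_ge0.
    rewrite /= in_itv/= => /andP[ha a1].
    have a01 : (0 < a <= 1)%R by apply/andP; split; lra.
    rewrite -poweR_EFin; apply: le_poweR; [exact: ltW|exact: cut_dist_ge0|].
    have ua y : cut u a y -> (edist y 0 <= r)%R.
      by move=> uy; apply: (rU _ Uu); apply: cut_subset uy => //; lra.
    have va y : cut v a y -> (edist y 0 <= s)%R.
      by move=> vy; apply: vs; apply: cut_subset vy => //; lra.
    have [u0 {}v0] := conj ((cuts u).2 _ a01).2 (cv.2 _ a01).2.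
    rewrite /cut_dist hausdorffE ge_max excess_finite//= addrC.
    exact: excess_finite.
  rewrite integral_cst_itv// opprB addrCA subrr addr0 lee_fin.
  apply: (@le_trans _ _ ((q + 1) * h)%R); first by apply: ler_wpM2r; [exact: ltW|rewrite lerDl].
  by rewrite mulrC -ler_pdivlMr.
have mg : measurable_fun `](h + h)%R, (1 - h + h)%R] (cut_gap h u).
  apply: measurable_funS (measurable_cut_gap (ltW h0) (cuts u)) => //.
  move=> x /=; rewrite !in_itv/= subrK => /andP[hx ->]; rewrite andbT.
  by apply: lt_trans hx; rewrite ltrDl.
apply: (@le_trans _ _ (c%:E * (\int[mu]_(a in `]h, (1 - h)%R]) (cst b%:E a) `^ p +
    \int[mu]_(a in `]h, (1 - h)%R]) cut_gap h u a `^ p +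
    \int[mu]_(a in `]h, (1 - h)%R]) cut_gap h u (a + h)%R `^ p))).
  have hD x : `]h, (1 - h)%R]%classic x -> (h < x <= 1 - h)%R by rewrite /= in_itv.
  have hx1 x : (h < x <= 1 - h)%R -> (h < x <= 1)%R by move=> /andP[-> /le_trans->].
  have hxh x : (h < x <= 1 - h)%R -> (h < x + h <= 1)%R.
    by move=> /andP[hx xh]; apply/andP; split; lra.
  apply: integral_poweRD3_le => //.
  - exact: ltW.
  - by apply: measurable_funS (measurable_cut_gap (ltW h0) (cuts u)) => //.
  - exact: measurable_fun_shift.
  - by move=> x /hD/hx1/andP[hx x1]; apply: cut_dist_ge0 => //; rewrite x1 (lt_trans h0).
  - by move=> x _; rewrite lee_fin ltW.
  - by move=> x /hD/hx1 hx; exact: cut_gap_ge0 (ltW h0) hx.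
  - by move=> x /hD/hxh hx; exact: cut_gap_ge0 (ltW h0) hx.
  move=> x /hD hx; have [i [j [ix jx i0 j1]]] := grid_points h0 hx.
  have i01' : (0 < i%:R * (h / 2) <= 1)%R.
    by rewrite i0 ltW//; case/andP : ix => _ /lt_le_trans; apply; case/andP : hx => _; lra.
  have j01 : (0 < j%:R * (h / 2) <= 1)%R.
    by rewrite j1 andbT; case/andP : jx => xj _; case/andP : hx => hx _; lra.
  apply: (cut_dist_level subK (cuts u) h0 hx ix jx).
    exact: (uK i i01').1.
  exact: (uK j j01).2.
apply: lee_wpmul2l; first by rewrite lee_fin ltW.
apply: leeD; first apply: leeD.
- rewrite (integral_cst_poweR b p hh) be lee_fin ler_piMr//; first exact: ltW.
  by lra.
- apply: le_trans Gh; apply: integral_itvS => //.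
    by apply: measurable_fun_poweR; apply: measurable_cut_gap => //; exact: ltW.
  by move=> x _; exact: poweR_ge0.
- rewrite (@ge0_integral_shift _ (fun x => cut_gap h u x `^ p)).
  + apply: le_trans Gh; apply: integral_itvS => //.
    * by rewrite lerDl ltW.
    * by rewrite subrK.
    * by apply: measurable_fun_poweR; apply: measurable_cut_gap => //; exact: ltW.
    * by move=> x _; exact: poweR_ge0.
  + exact: measurable_fun_poweR.
  + by move=> x _; exact: poweR_ge0.
Qed.

(** For each [h] some [u] in [U] is close to [v] on []h, 1]]. It may change with [h], but the
    resulting bound does not, and monotone convergence extends it to []0, 1]]. *)
Let Dp_v : Dp p v zerohat < +oo.
Proof.
have [M M0 MU] := Dp_uniform_bound.
have [d /andP[d0 d1] dF] := near_integral_cut_dist ltr01.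
have mv : measurable_fun `](0 : R)%R, 1%R] (cut_dist v zerohat) by exact: measurable_cut_dist.
suff H h : (0 < h <= d)%R ->
    \int[mu]_(a in `]h, 1%R]) cut_dist v zerohat a `^ p <= (c * (M + 1))%:E.
  apply: (@le_lt_trans _ _ (c * (M + 1))%:E); last exact: ltry.
  have cvg := cvg_integral_itv0 (measurable_fun_poweR p mv) (fun x _ => poweR_ge0 _ p).
  rewrite leNgt; apply/negP => ltD.
  have nI : nbhs (Dp p v zerohat) [set y | (c * (M + 1))%:E < y].
    by apply: open_nbhs_nbhs; split => //; exact: open_ereal_gt_ereal.
  have [N _ NP] := cvg _ nI.
  (* Large enough for the convergence and for [1 / (n + 1) <= d]. *)
  pose n := maxn N (Num.truncn d^-1).
  have := NP n (leq_maxl _ _); rewrite /= ltNge => /negP; apply; apply: H.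
  rewrite invr_gt0 ltr0n/= -[leRHS]invrK lef_pV2 ?posrE ?invr_gt0 ?ltr0n//.
  by rewrite (le_trans (ltW (truncnS_gt _)))// ler_nat ltnS leq_maxr.
move=> hd; have /andP[h0 hd'] := hd.
have [u [Uu /= uh]] := filter_ex (filterI FU (dF h hd)).
have subh : `]h, 1%R]%classic `<=` `](0 : R)%R, 1%R]%classic.
  by move=> x /=; rewrite !in_itv/= => /andP[/(lt_trans h0)->].
have mu0 := measurable_zerohat_dist u.
have muv : measurable_fun `](0 : R)%R, 1%R] (cut_dist u v) by exact: measurable_cut_dist.
apply: (@le_trans _ _ (c%:E * (\int[mu]_(a in `]h, 1%R]) cut_dist u zerohat a `^ p +
    \int[mu]_(a in `]h, 1%R]) cut_dist u v a `^ p +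
    \int[mu]_(a in `]h, 1%R]) (cst 0 a) `^ p))).
  have hD x : `]h, 1%R]%classic x -> (0 < x <= 1)%R by move=> /subh; rewrite in_itv01.
  apply: integral_poweRD3_le => //.
  - exact: ltW.
  - exact: measurable_funS mu0.
  - exact: measurable_funS muv.
  - by move=> x /hD; exact: cut_dist_ge0.
  - by move=> x /hD; exact: cut_dist_ge0.
  - by move=> x /hD; exact: cut_dist_ge0.
  move=> x /hD x01; rewrite adde0 addeC (cut_distC u v).
  exact: cut_dist_triangle.
have -> : \int[mu]_(a in `]h, 1%R]) (cst 0 a) `^ p = 0.
  by apply: integral0_eq => a _; rewrite poweR0r ?gt_eqF.
rewrite adde0 EFinM; apply: lee_wpmul2l; first by rewrite lee_fin ltW.
rewrite EFinD; apply: leeD => //; apply: le_trans (MU _ Uu).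
apply: ge0_subset_integral => //; first exact: measurable_fun_poweR.
by move=> x _; exact: poweR_ge0.
Qed.

Let FBp_v : in_FBp p v.
Proof.
split.
- exact: level_function_fuzzy.
- exact: level_function_normal.
- exact: level_function_usc.
- by rewrite (Dp_zerohatE p cv); exact: poweR_lty.
Qed.

(** The integral is split at a small [h], fixed before [u]: on []0, h]] both [u] and [v] are close
    to the origin in p-mean, and on []h, 1]] they are close to each other. *)
Lemma ultra_limit : exists w : FBp m p, F --> w.
Proof.
exists (MkFBp FBp_v) => A /(nbhs_dpP p1)[e e0 eA].
suff FE : F [set u : FBp m p | Dp p u v < (e `^ p)%:E].
  apply: filterS FE => u /= uv; apply: eA => /=.
  by rewrite (d_C p v u) (d_E p (cuts u) cv) poweRV_lt// Dp_ge0.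
set E := (e `^ p)%R; have E0 : (0 < E)%R by rewrite powR_gt0.
have E40 : (0 < E / 4)%R by rewrite divr_gt0.
have E4c0 : (0 < E / 4 / c)%R by rewrite divr_gt0.
have mv : measurable_fun `](0 : R)%R, 1%R] (cut_dist v zerohat) by exact: measurable_cut_dist.
have [d /andP[d0 d1] dF] := near_integral_cut_dist E40.
have [d' d'0 d'U] := initial_uniform_small E4c0.
have [k /andP[k0 k1] kv] : exists2 k : R, (0 < k <= 1)%R &
    \int[mu]_(x in `]0%R, k]) cut_dist v zerohat x `^ p <= (E / 4 / c)%:E.
  apply: integral_itv0_small => //; first exact: measurable_fun_poweR.
  by move=> x _; exact: poweR_ge0.
pose h := Num.min d (Num.min d' k).
have h0 : (0 < h)%R by rewrite !lt_min d0 d'0.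
have hd : (h <= d)%R by rewrite ge_min lexx.
have hd' : (h <= d')%R by rewrite !ge_min lexx orbT.
have hk : (h <= k)%R by rewrite !ge_min lexx !orbT.
have h1 : (h <= 1)%R by exact: le_trans k1.
have h0d : (0 < h <= d)%R by rewrite h0.
apply: filterS (filterI FU (dF h h0d)) => u [Uu /= uh].
have muv : measurable_fun `](0 : R)%R, 1%R] (cut_dist u v) by exact: measurable_cut_dist.
have mu0 := measurable_zerohat_dist u.
have sub : `](0 : R)%R, h]%classic `<=` `](0 : R)%R, 1%R]%classic.
  by move=> x /=; rewrite !in_itv/= => /andP[-> /le_trans->].
rewrite /Dp (integral_itv_split (ltW h0) h1); last 2 first.
  exact: measurable_fun_poweR.
  by move=> x _; exact: poweR_ge0.
apply: (@le_lt_trans _ _ (c * (E / 4 / c + E / 4 / c + 0) + E / 4)%:E); last first.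
  rewrite lte_fin.
  have -> : (c * (E / 4 / c + E / 4 / c + 0) + E / 4 = E * (3 / 4))%R by field; rewrite gt_eqF.
  by rewrite gtr_pMr//; lra.
rewrite EFinD EFinM !EFinD; apply: leeD => //.
apply: (@le_trans _ _ (c%:E * (\int[mu]_(a in `]0%R, h]) cut_dist u zerohat a `^ p +
    \int[mu]_(a in `]0%R, h]) cut_dist v zerohat a `^ p +
    \int[mu]_(a in `]0%R, h]) (cst 0 a) `^ p))).
  have hD x : `]0%R, h]%classic x -> (0 < x <= 1)%R by move=> /sub; rewrite in_itv01.
  apply: integral_poweRD3_le => //.
  - exact: ltW.
  - exact: measurable_funS mu0.
  - exact: measurable_funS mv.
  - by move=> x /hD; exact: cut_dist_ge0.
  - by move=> x /hD; exact: cut_dist_ge0.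
  - by move=> x /hD; exact: cut_dist_ge0.
  move=> x /hD x01; rewrite adde0 (cut_distC v zerohat).
  exact: cut_dist_triangle.
apply: lee_wpmul2l; first by rewrite lee_fin ltW.
apply: leeD; first apply: leeD.
- by apply: d'U => //; rewrite ltW.
- apply: le_trans kv; apply: integral_itvS => //; last by move=> x _; exact: poweR_ge0.
  apply: measurable_fun_poweR; apply: measurable_funS mv => //.
  by move=> x /=; rewrite !in_itv/= => /andP[-> /le_trans->].
- by rewrite integral0_eq// => a _; rewrite poweR0r ?gt_eqF.
Qed.

End ultrafilter_limit.

Theorem theorem6p16 (R : realType) (m : nat) (p : R)
    (X : set ('rV[R]_m -> R)) (U : set (FBp m p)) :
  (1 <= m)%N -> 1 <= p ->
  [\/ X = Stilde R m, X = E_ R m, X = S0_ R m | X = S_ R m] ->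
  let Xp : set (FBp m p) := [set u : FBp m p | X u] in
  U `<=` Xp ->
  @compact (subspace Xp) U <->
  [/\ uniformly_mean_bounded U, mean_equi_left_continuous U & closure U = U].
Proof.
move=> _ p1 _ Xp UX; have UE : U = U `&` Xp by apply/esym/setIidPl.
have subspaceE : @compact (subspace Xp) U <-> compact U.
  by rewrite UE; exact: compact_subspaceIP.
apply: (iff_trans subspaceE); split=> [cU|[bU eU clU]].
  split; [exact: compact_mean_bounded|exact: compact_mean_equi_left_continuous|].
  by rewrite -(closure_id U).1//; apply: compact_closed cU; exact: FBp_hausdorff.
rewrite compact_ultra => F UF FU.
have [w Fw] := ultra_limit p1 bU eU FU.
(* Every neighbourhood of [w] belongs to [F], as [U] does, hence meets [U]; so [w] lies in the
   closure of [U], which is [U]. *)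
exists w; split => //; rewrite -clU => A /Fw FA.
exact: filter_ex (filterI FU FA).
Qed.
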